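(* Let $K\in\mathcal K$. Assume that $A^s(K)$ is closed in measure and that the no-arbitrage condition $$NA(K):\quad A_T(0;K)\cap L^0(\mathbb R^d_+;\mathcal F)=\{0\}$$ holds. Then, for every probability measure $\tilde{\mathbb P}\sim\mathbb P$, there is $Z\in\mathcal D(K,\tilde{\mathbb P})$ with values in $(0,\infty)^d$. Moreover, for $\vartheta\in L^0(\mathbb R^d;\mathbb F)$ the following assertions are equivalent: (i) $\vartheta\in A^s(K)$; (ii) for all $\tilde{\mathbb P}\sim\mathbb P$ and all $Z\in\mathcal D(K,\tilde{\mathbb P})$ such that $(\vartheta\cdot Z)^-\in L^1(\mathbb R;\mathbb F,\tilde{\mathbb P})$, we have $\mathbb E^{\tilde{\mathbb P}}\big[\sum_{t=0}^T\vartheta_t\cdot Z_t\big]\le 0$; (iii) for some $\tilde{\mathbb P}\sim\mathbb P$, we have $\mathbb E^{\tilde{\mathbb P}}\big[\sum_{t=0}^T\vartheta_t\cdot Z_t\big]\le 0$ for all $Z\in\mathcal D(K,\tilde{\mathbb P})$ such that $(\vartheta\cdot Z)^-\in L^1(\mathbb R;\mathbb F,\tilde{\mathbb P})$.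
   Context: Setting: $\mathbb T=\{0,\dots,T\}$ with an integer $T\ge1$; $(\Omega,\mathcal F,\mathbb P)$ is a complete probability space with filtration $\mathbb F=(\mathcal F_t)_{t\in\mathbb T}$, $\mathcal F_T=\mathcal F$, $\mathcal F_0$ trivial; $d\ge1$ is an integer. Relations between random variables (equality, inequality, membership in random sets) are understood $\mathbb P$-a.s. For a random set $E\subset\mathbb R^d$, $L^0(E;\mathbb F)$ (resp. $L^0(E;\mathcal G)$ for $\mathcal G\subset\mathcal F$) is the set of $\mathbb F$-adapted processes indexed by $\mathbb T$ (resp. $\mathcal G$-measurable random variables) with values in $E$; $L^1(E;\mathbb F,\tilde{\mathbb P})$ is the subset of processes in $L^0(E;\mathbb F)$ that are $\tilde{\mathbb P}$-integrable at every $t\in\mathbb T$. The symbol $\cdot$ is the scalar product of $\mathbb R^d$; $\vartheta\cdot Z$ is the process $(\vartheta_t\cdot Z_t)_{t\in\mathbb T}$; $a^-$ is the negative part of $a$. A $\mathcal C$-valued process is a sequence $K=(K_t)_{t\in\mathbb T}$ of set-valued maps for which there is a countable sequence of $\mathbb R^d$-valued $\mathbb F$-adapted processes $X^n=(X^n_t)_{t\in\mathbb T}$ such that, for every $t\in\mathbb T$, $\mathbb P$-a.s. only a finite but non-zero number of the $X^n_t$ are different from zero, and $K_t=\mathrm{cone}\{X^n_t: n\in\mathbb N\}$ (the polyhedral convex cone generated by them). $\mathcal K$ is the set of $\mathcal C$-valued processes $K$ with $\mathbb R^d_+\setminus\{0\}\subset\mathrm{int}(K_t)$ for all $t\in\mathbb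 T$. The positive polar is $K^*_t(\omega)=\{y\in\mathbb R^d: x\cdot y\ge0\ \forall x\in K_t(\omega)\}$. For $K\in\mathcal K$ and $x\in\mathbb R^d$: $\mathcal A(K)=\{\xi\in L^0(\mathbb R^d;\mathbb F):\xi_t\in -K_t\ \forall t\in\mathbb T\}$; $V^{x,\xi}_t=x+\sum_{s=0}^t\xi_s$; $A(x;K)=\{V^{x,\xi}:\xi\in\mathcal A(K)\}$; $A_t(x;K)=\{V_t:V\in A(x;K)\}$; $A^s(x;K)=\{\vartheta\in L^0(\mathbb R^d;\mathbb F): \exists V\in A(x;K)\text{ with }V_t-\vartheta_t\in K_t\ \forall t\in\mathbb T\}$; $A^s(K)=A^s(0;K)$. A subset $B\subset L^0(\mathbb R^d;\mathbb F)$ is closed in measure if it is closed under convergence in probability when identified with a subset of $L^0(\mathbb R^{d\times(T+1)};\mathcal F)$: if $v^n\in B$ and $\lim_n\mathbb P[\sum_{t\in\mathbb T}\|v^n_t-v_t\|>\varepsilon]=0$ for all $\varepsilon>0$, then $v\in B$. For $\tilde{\mathbb P}\sim\mathbb P$, $\mathcal D(K,\tilde{\mathbb P})$ is the set of processes $Z\in L^1(\mathbb R^d_+;\mathbb F,\tilde{\mathbb P})$ such that for all $t\in\mathbb T$: $Z_t\in K_t^*$ and $\bar Z_t:=\mathbb E^{\tilde{\mathbb P}}[\sum_{s=t}^TZ_s\mid\mathcal F_t]\in K_t^*$. *)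

(* Defs.v *)
From HB Require Import structures.
From mathcomp Require Import all_boot all_order all_algebra.
From mathcomp Require Import all_classical all_reals all_analysis.

Set Implicit Arguments.
Unset Strict Implicit.
Unset Printing Implicit Defensive.

Import Order.TTheory GRing.Theory Num.Theory.
Import numFieldNormedType.Exports.

Local Open Scope classical_set_scope.
Local Open Scope ring_scope.

(* Conventions.  Time is 'I_T.+1 = {0, ..., T}.  Random variables are actual
   functions on Omega and the relations between them are required P-a.s.
   Measurability with respect to a sub-sigma-algebra is required literally,
   without modification on a null set. *)

Section Euclidean.
Context {R : realType} {d : nat}.
Implicit Types (x y : 'rV[R]_d) (C : set 'rV[R]_d).

Definition dot x y : R := \sum_(i < d) x 0 i * y 0 i.

Definition enorm x : R := Num.sqrt (dot x x).

Definition orthant : set 'rV[R]_d := [set x | forall i, 0 <= x 0 i].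

Definition pos_orthant : set 'rV[R]_d := [set x | forall i, 0 < x 0 i].

Definition polar C : set 'rV[R]_d :=
  [set y | forall x, C x -> 0 <= dot x y].

Definition cone (X : nat -> 'rV[R]_d) : set 'rV[R]_d :=
  [set y | exists (N : nat) (a : nat -> R),
     (forall n, 0 <= a n) /\ y = \sum_(n < N) a n *: X n].

End Euclidean.

Section Market.
Context {disp : measure_display} {Omega : measurableType disp} {R : realType}.
Implicit Types (P Q : probability Omega R) (G : set (set Omega)).

Definition measurable_wrt G (X : Omega -> R) : Prop :=
  measurable_fun (setT : set (g_sigma_algebraType G))
    (X : g_sigma_algebraType G -> R).

(* "F_0 trivial" is meant up to null sets. *)
Definition filtration P (T : nat) (F : 'I_T.+1 -> set (set Omega)) : Prop :=
  [/\ forall t, sigma_algebra setT (F t),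
      forall s t : 'I_T.+1, (s <= t)%N -> F s `<=` F t,
      F ord_max = measurable &
      forall A, F ord0 A -> P A = 0%E \/ P A = 1%E].

Definition equiv_prob P Q : Prop := Q `<< P /\ P `<< Q.

Definition integrable_rv Q (X : Omega -> R) : Prop :=
  Q.-integrable setT (EFin \o X).

Definition is_condexp Q G (X Y : Omega -> R) : Prop :=
  [/\ measurable_wrt G Y, integrable_rv Q Y &
      forall A, G A ->
        (\int[Q]_(w in A) (Y w)%:E = \int[Q]_(w in A) (X w)%:E)%E].

Definition L1_real_process Q (T : nat) (F : 'I_T.+1 -> set (set Omega))
    : set ('I_T.+1 -> Omega -> R) :=
  [set X | forall t, measurable_wrt (F t) (X t) /\ integrable_rv Q (X t)].

Section Processes.
Context {d T : nat}.
Implicit Types (F : 'I_T.+1 -> set (set Omega)) (E : Omega -> set 'rV[R]_d).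

(* L^0(E; G) for a random variable and a random set E; the Borel
   sigma-algebra of R^d is the product one, hence the coordinates. *)
Definition L0 P E G : set (Omega -> 'rV[R]_d) :=
  [set X : Omega -> 'rV[R]_d |
    (forall i, measurable_wrt G (fun w => X w 0 i)) /\
    {ae P, forall w, E w (X w)}].

Definition process := 'I_T.+1 -> Omega -> 'rV[R]_d.

Definition cone_process := 'I_T.+1 -> Omega -> set 'rV[R]_d.

Definition L0_process P E F : set process :=
  [set X : process | forall t, L0 P E (F t) (X t)].

Definition L1_process P Q E F : set process :=
  [set X : process | L0_process P E F X /\
           forall t i, integrable_rv Q (fun w => X t w 0 i)].

Definition C_valued P F (K : cone_process) : Prop :=
  exists X : nat -> process,
    (forall n, L0_process P (fun=> setT) F (X n)) /\
    forall t, {ae P, forall w,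
      [/\ finite_set [set n | X n t w != 0],
          [set n | X n t w != 0] !=set0 &
          K t w = cone (fun n => X n t w)]}.

Definition in_calK P F (K : cone_process) : Prop :=
  C_valued P F K /\
  forall t, {ae P, forall w,
    @orthant R d `\ 0 `<=` interior (K t w)}.

Definition calA P F (K : cone_process) : set process :=
  [set xi : process | L0_process P (fun=> setT) F xi /\
            forall t, {ae P, forall w, K t w (- xi t w)}].

Definition portfolio (x : 'rV[R]_d) (xi : process) : process :=
  fun t w => x + \sum_(s < T.+1 | (s <= t)%N) xi s w.

Definition attainable P F (x : 'rV[R]_d) (K : cone_process) : set process :=
  [set portfolio x xi | xi in calA P F K].

Definition attainable_at P F (x : 'rV[R]_d) (K : cone_process) (t : 'I_T.+1)
    : set (Omega -> 'rV[R]_d) :=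
  [set V t | V in attainable P F x K].

Definition attainable_s P F (x : 'rV[R]_d) (K : cone_process) : set process :=
  [set theta : process | L0_process P (fun=> setT) F theta /\
     exists2 V, attainable P F x K V &
       forall t, {ae P, forall w, K t w (V t w - theta t w)}].

(* The limit v is merely F-measurable, so that it belongs to B only as a class
   modulo a.s. equality, i.e. it has a version in B. *)
Definition closed_in_measure P (B : set process) : Prop :=
  forall (vn : nat -> process) (v : process),
    (forall n, B (vn n)) ->
    (forall t, L0 P (fun=> setT) measurable (v t)) ->
    (forall eps : R, 0 < eps ->
       (fun n => P [set w | eps < \sum_t enorm (vn n t w - v t w)])
         @ \oo --> 0%E) ->
    exists2 v', B v' & forall t, {ae P, forall w, v t w = v' t w}.

(* {0} is written L^0({0}; F): the random variables that vanish a.s. *)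
Definition NA P F (K : cone_process) : Prop :=
  attainable_at P F 0 K ord_max `&` L0 P (fun=> orthant) measurable
  = L0 P (fun=> [set 0]) measurable.

(* Zb is a version of the conditional expectation of sum_(s >= t) Z_s given
   F_t; conditional expectations are determined only a.s. *)
Definition calD P F (K : cone_process) Q : set process :=
  [set Z : process | L1_process P Q (fun=> orthant) F Z /\
     forall t, {ae P, forall w, polar (K t w) (Z t w)} /\
       exists Zb : Omega -> 'rV[R]_d,
         (forall i, is_condexp Q (F t)
            (fun w => (\sum_(s < T.+1 | (t <= s)%N) Z s w) 0 i)
            (fun w => Zb w 0 i)) /\
         {ae P, forall w, polar (K t w) (Zb w)}].

(* (theta . Z)^- is integrable at every date *)
Definition neg_part_L1 F Q (theta Z : process) : Prop :=
  L1_real_process Q F (fun t => (fun w => dot (theta t w) (Z t w))^\-).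

(* Extended-real valued: it is in ]-oo, +oo] under neg_part_L1. *)
Definition pairing Q (theta Z : process) : \bar R :=
  ('E_Q[(fun w => \sum_t dot (theta t w) (Z t w))%R])%E.

End Processes.
End Market.
Arguments process {disp} Omega R d T.
Arguments cone_process {disp} Omega R d T.

(* Main.v *)
Require Import Defs.
From mathcomp Require Import all_boot all_order all_algebra.
From mathcomp Require Import all_classical all_reals all_analysis.
From mathcomp Require Import finmap measurable_realfun ring lra.

Set Implicit Arguments.
Unset Strict Implicit.
Unset Printing Implicit Defensive.

Import Order.TTheory GRing.Theory Num.Theory.
Import numFieldNormedType.Exports.

Local Open Scope classical_set_scope.
Local Open Scope ring_scope.

(** The set A^s(K) of super-attainable claims is a convex cone, and for every
    Q equivalent to P the set D(K, Q) describes the half-spaces that contain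
    it.

    The assertion (iii) -> (i) and the existence of a positive process rest on
    separation.  If theta is not in A^s(K), multiply date t by the adapted
    weight g_t = exp(- |theta_t|^2): the process g theta is bounded, and the
    processes u with u / g in A^s(K) form a convex cone that is closed under
    almost sure limits, because A^s(K) is closed in measure.  In the Hilbert
    space of adapted square integrable processes under Q, project g theta on
    this cone (cone_projection, cone_separation); the residual Y and
    Z = g Y satisfy E[sum theta.Z] > 0 and E[sum v.Z] <= 0 for the bounded v of
    A^s(K) (separating_claims).  Such a Z belongs to D(K, Q)
    (polar_claims_calD): test it against the claim - k at the single date t
    with k in K_t, to get Z_t in the polar of K_t, and against the portfolio
    that is changed by - k at date t and kept afterwards, to get the same for
    the conditional expectation of the sum of the Z_s with s >= t.

    Under no arbitrage the claim of one unit of asset i at date t on an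
    F_t-event B is in A^s(K) only if B is null (no_arbitrage_claim), for it
    could be cashed at t and carried to T.  So every non-null event is charged
    by some coordinate of a separating Z.  Weighted series of such processes
    stay in the class, and an exhaustion argument yields one that is positive
    everywhere (exists_positive_claims).

    For (i) -> (ii), let V be the portfolio that dominates theta.  Then
    theta.Z <= V.Z at each date, and with Zb_t the conditional expectation of
    the tail sum of Z, the variables
    N_t = V_t.Zb_t + (sum of V_s.Z_s over s < t) form a supermartingale up to
    integrability, which starts at a nonpositive value and ends at
    sum V.Z.  The terminal value has an integrable negative part.
    Integrability of the negative parts goes down from the last date to the
    first, and then integrability and the sign of the mean go up from the
    first date to the last (generalised_supermartingale,
    attainable_pairing_le0). *)

(** * Expectation of real random variables *)

Section Expectation.
Context {disp : measure_display} {Omega : measurableType disp} {R : realType}.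
Variable Q : probability Omega R.
Implicit Types X Y Z : Omega -> R.

Lemma integrable_rv_measurable X : integrable_rv Q X -> measurable_fun setT X.
Proof. by move=> /measurable_int/measurable_EFinP. Qed.

Lemma integrable_rv_le X Y : measurable_fun setT X -> integrable_rv Q Y ->
  (forall w, `|X w| <= `|Y w|) -> integrable_rv Q X.
Proof.
move=> mX iY le; apply: le_integrable iY => //; first exact/measurable_EFinP.
by move=> w _ /=; rewrite lee_fin.
Qed.

Lemma integrable_rv_eq_ae X Y : measurable_fun setT Y -> integrable_rv Q X ->
  {ae Q, forall w, X w = Y w} -> integrable_rv Q Y.
Proof.
move=> mY iX XY; apply/integrableP; split; first exact/measurable_EFinP.
case/integrableP: (iX) => mX; rewrite (@ae_eq_integral _ _ _ _ _ (fun w => `|(Y w)%:E|%E))//.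
- by apply/measurableT_comp => //.
- by apply/measurableT_comp => //; exact/measurable_EFinP.
- by apply: filterS XY => w + _ /= => ->.
Qed.

(** X agrees almost surely with its truncation between - |Y| and |Y|. *)
Lemma integrable_rv_le_ae X Y : measurable_fun setT X -> integrable_rv Q Y ->
  {ae Q, forall w, `|X w| <= Y w} -> integrable_rv Q X.
Proof.
move=> mX iY XY; have mY := integrable_rv_measurable iY.
pose X' w := Num.max (- `|Y w|) (Num.min (X w) `|Y w|).
have mX' : measurable_fun setT X'.
  apply: measurable_maxr; first by apply: measurable_funN; exact: measurableT_comp.
  by apply: measurable_minr => //; exact: measurableT_comp.
have iX' : integrable_rv Q X'.
  apply: (integrable_rv_le mX' iY) => w; rewrite /X' ler_norml.
  by rewrite le_max lexx/= ge_max ge_min lexx orbT andbT (le_trans _ (normr_ge0 _))// oppr_le0.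
apply: (integrable_rv_eq_ae mX iX'); apply: filterS XY => w XYw.
have := le_trans XYw (ler_norm _); rewrite ler_norml => /andP[h1 h2].
by rewrite /X' min_l// max_r.
Qed.

Lemma integrable_rvD X Y : integrable_rv Q X -> integrable_rv Q Y ->
  integrable_rv Q (fun w => X w + Y w).
Proof.
move=> iX iY; have := integrableD measurableT iX iY.
by apply: eq_integrable => // w _ /=; rewrite EFinD.
Qed.

Lemma integrable_rvZ (c : R) X : integrable_rv Q X -> integrable_rv Q (fun w => c * X w).
Proof.
move=> iX; have := integrableZl measurableT c iX.
by apply: eq_integrable => // w _ /=; rewrite EFinM.
Qed.

Lemma integrable_rvN X : integrable_rv Q X -> integrable_rv Q (fun w => - X w).
Proof.
move=> iX; have := integrable_rvZ (-1) iX.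
by apply: eq_integrable => // w _ /=; rewrite mulN1r.
Qed.

Lemma integrable_rvB X Y : integrable_rv Q X -> integrable_rv Q Y ->
  integrable_rv Q (fun w => X w - Y w).
Proof. by move=> iX /integrable_rvN; exact: integrable_rvD. Qed.

Lemma integrable_rv_cst c : integrable_rv Q (fun=> c).
Proof. exact: finite_measure_integrable_cst. Qed.

Lemma integrable_rv_sum (I : Type) (s : seq I) (p : pred I) (X : I -> Omega -> R) :
  (forall i, p i -> integrable_rv Q (X i)) ->
  integrable_rv Q (fun w => \sum_(i <- s | p i) X i w).
Proof.
move=> iX; elim: s => [|i s IH].
  rewrite (_ : (fun _ => _) = (fun=> 0)); first exact: integrable_rv_cst.
  by apply/funext => w; rewrite big_nil.
rewrite (_ : (fun _ => _) = (fun w => if p i then X i w + \sum_(j <- s | p j) X j w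
    else \sum_(j <- s | p j) X j w)); last by apply/funext => w; rewrite big_cons.
by case: (boolP (p i)) => // pi; apply: integrable_rvD => //; exact: iX.
Qed.

Lemma integrable_rv_norm X : integrable_rv Q X -> integrable_rv Q (fun w => `|X w|).
Proof. by move=> /(integrable_norm). Qed.

Lemma integrable_rvM_bounded (c : R) (f : Omega -> R) X : measurable_fun setT f ->
  (forall w, `|f w| <= c) -> integrable_rv Q X -> integrable_rv Q (fun w => f w * X w).
Proof.
move=> mf fc iX.
apply: (@integrable_rv_le _ (fun w => c * X w)); last 2 first.
- exact: integrable_rvZ.
- move=> w; rewrite !normrM ler_wpM2r//.
  by rewrite (le_trans (fc w))// ler_norm.
- by apply: measurable_funM => //; exact: integrable_rv_measurable.
Qed.

Lemma meanD X Y : integrable_rv Q X -> integrable_rv Q Y ->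
  \int[Q]_w (X w + Y w) = \int[Q]_w X w + \int[Q]_w Y w.
Proof. exact: RintegralD. Qed.

Lemma meanB X Y : integrable_rv Q X -> integrable_rv Q Y ->
  \int[Q]_w (X w - Y w) = \int[Q]_w X w - \int[Q]_w Y w.
Proof. exact: RintegralB. Qed.

Lemma meanZ (c : R) X : integrable_rv Q X ->
  \int[Q]_w (c * X w) = c * \int[Q]_w X w.
Proof. exact: RintegralZl. Qed.

Lemma mean_sum (I : Type) (s : seq I) (p : pred I) (X : I -> Omega -> R) :
  (forall i, p i -> integrable_rv Q (X i)) ->
  \int[Q]_w (\sum_(i <- s | p i) X i w) = \sum_(i <- s | p i) \int[Q]_w X i w.
Proof.
move=> iX; elim: s => [|i s IH].
  rewrite big_nil -[RHS](mul0r (fine (Q setT))) -Rintegral_cst//.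
  by apply: eq_Rintegral => w _; rewrite big_nil.
rewrite big_cons -IH; case: ifPn => pi.
  rewrite -meanD//; [|exact: iX|exact: integrable_rv_sum].
  by apply: eq_Rintegral => w _; rewrite big_cons pi.
by apply: eq_Rintegral => w _; rewrite big_cons (negbTE pi).
Qed.

Lemma mean_eq_ae X Y : measurable_fun setT X -> measurable_fun setT Y ->
  {ae Q, forall w, X w = Y w} -> \int[Q]_w X w = \int[Q]_w Y w.
Proof.
move=> mX mY XY; congr fine; apply: ae_eq_integral => //.
- exact/measurable_EFinP.
- exact/measurable_EFinP.
- by apply: filterS XY => w + _ => ->.
Qed.

Lemma mean_ge0_ae X : measurable_fun setT X -> {ae Q, forall w, 0 <= X w} ->
  0 <= \int[Q]_w X w.
Proof.
move=> mX X0; rewrite (@mean_eq_ae X (fun w => Num.max (X w) 0))//.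
- by apply: Rintegral_ge0 => w _; rewrite le_max lexx orbT.
- exact: measurable_maxr.
- by apply: filterS X0 => w /max_idPl.
Qed.

Lemma mean_le_ae X Y : integrable_rv Q X -> integrable_rv Q Y ->
  {ae Q, forall w, X w <= Y w} -> \int[Q]_w X w <= \int[Q]_w Y w.
Proof.
move=> iX iY XY; rewrite -subr_ge0 -meanB//; apply: mean_ge0_ae.
- by apply: measurable_funB; exact: integrable_rv_measurable.
- by apply: filterS XY => w; rewrite subr_ge0.
Qed.

Lemma mean_eq0 X : integrable_rv Q X -> {ae Q, forall w, 0 <= X w} ->
  \int[Q]_w X w <= 0 -> {ae Q, forall w, X w = 0}.
Proof.
move=> iX X0 EX; have mX := integrable_rv_measurable iX.
have EX0 : \int[Q]_w `|X w| = 0.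
  rewrite (@mean_eq_ae _ X)//; last 2 first.
  - exact: measurableT_comp.
  - by apply: filterS X0 => w /ger0_norm.
  by apply/eqP; rewrite eq_le EX mean_ge0_ae.
have : ae_eq Q setT (EFin \o X) (cst 0%E).
  apply/ae_eq_integral_abs => //; first exact/measurable_EFinP.
  have := EFin_normr_Rintegral measurableT (integrable_rv_norm iX).
  have fn : (\int[Q]_w `|X w|%:E)%E \is a fin_num.
    by apply: integrable_fin_num => //; exact: integrable_rv_norm.
  by move=> _; rewrite -(fineK fn) -/(Rintegral Q setT (fun w => `|X w|)) EX0.
by apply: filterS => w /(_ I) [].
Qed.

Lemma meanE X : integrable_rv Q X -> (\int[Q]_w (X w)%:E = (\int[Q]_w X w)%:E)%E.
Proof. by move=> iX; rewrite /Rintegral fineK//; apply: integrable_fin_num. Qed.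

Lemma mean_indic A X : measurable A ->
  \int[Q]_(w in A) X w = \int[Q]_w (\1_A w * X w).
Proof.
move=> mA; rewrite Rintegral_mkcond; apply: eq_Rintegral => w _.
by rewrite /patch indicE; case: ifP => _; rewrite ?mul1r ?mul0r.
Qed.

Lemma mean_cst (c : R) : \int[Q]_w (c : R) = c.
Proof.
rewrite Rintegral_cst// (_ : fine _ = 1) ?mulr1//.
exact: (congr1 (@fine R) (probability_setT Q)).
Qed.

(** A bound on the means, through the Fatou lemma, also gives integrability of
    the limit. *)
Lemma mean_fatou (X : nat -> Omega -> R) Y (c : R) :
  (forall n, integrable_rv Q (X n)) -> (forall n w, 0 <= X n w) ->
  measurable_fun setT Y -> (forall w, 0 <= Y w) ->
  {ae Q, forall w, X n w @[n --> \oo] --> Y w} ->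
  (\forall n \near \oo, \int[Q]_w X n w <= c) ->
  integrable_rv Q Y /\ \int[Q]_w Y w <= c.
Proof.
move=> iX X0 mY Y0 XY Xc.
have mX n : measurable_fun setT (EFin \o X n) by exact: measurable_int (iX n).
have mliminf : measurable_fun setT (fun w => limn_einf (fun n => (X n w)%:E)).
  rewrite (_ : (fun w => _) = (fun w => - limn_esup (fun n => (- X n w)%:E))%E).
    apply: measurableT_comp => //; apply: measurable_fun_limn_esup => n.
    by apply/measurable_EFinP; apply: measurable_funN; exact/measurable_EFinP.
  by apply/funext => w; rewrite -limn_einfN; congr limn_einf; apply/funext => n /=; rewrite opprK.
have le : (\int[Q]_w (Y w)%:E <= limn_einf (fun n => \int[Q]_w (X n w)%:E))%E.
  rewrite (_ : (\int[Q]_w _)%E = (\int[Q]_w limn_einf (fun n => (X n w)%:E))%E).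
    by apply: fatou => // n w _; rewrite lee_fin.
  apply: ae_eq_integral => //; first exact/measurable_EFinP.
  apply: filterS XY => w XY _ /=.
  have cv : ((X n w)%:E @[n --> \oo] --> (Y w)%:E)%E.
    by apply: cvg_EFin => //; exact: nearW.
  rewrite is_cvg_limn_einfE; last by apply/cvg_ex; exists (Y w)%:E.
  by apply/esym/cvg_lim.
have {}le : (\int[Q]_w (Y w)%:E <= c%:E)%E.
  apply: (le_trans le); rewrite limn_einf_lim.
  apply: lime_le; first exact: is_cvg_einfs.
  apply: filterS Xc => n Xc; apply: (@le_trans _ _ (\int[Q]_w (X n w)%:E)%E).
    by apply: ereal_inf_lbound; exists n => /=.
  by rewrite meanE.
have iY : integrable_rv Q Y.
  apply/integrableP; split; first exact/measurable_EFinP.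
  under eq_integral do rewrite /= ger0_norm//.
  by rewrite (le_lt_trans le) ?ltry.
by split => //; rewrite -lee_fin -meanE.
Qed.

Lemma mean_dominated (X : nat -> Omega -> R) Y Z :
  (forall n, measurable_fun setT (X n)) -> measurable_fun setT Y ->
  integrable_rv Q Z -> (forall n, {ae Q, forall w, `|X n w| <= Z w}) ->
  {ae Q, forall w, X n w @[n --> \oo] --> Y w} ->
  \int[Q]_w X n w @[n --> \oo] --> \int[Q]_w Y w.
Proof.
move=> mX mY iZ XZ XY.
have mEX n : measurable_fun setT (EFin \o X n) by exact/measurable_EFinP.
have mEY : measurable_fun setT (EFin \o Y) by exact/measurable_EFinP.
have cXY : {ae Q, forall w, setT w -> ((EFin \o X n) w @[n --> \oo] --> (EFin \o Y) w)%E}.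
  by apply: filterS XY => w XY _; apply: cvg_EFin => //; exact: nearW.
have bXZ : {ae Q, forall w n, setT w -> (`|(EFin \o X n) w| <= (EFin \o Z) w)%E}.
  by apply: filterS (ae_foralln XZ) => w XZ' n _; rewrite lee_fin; exact: XZ'.
have [iY _ cv] := dominated_convergence measurableT mEX mEY cXY iZ bXZ.
by apply: fine_cvg; rewrite -(meanE iY).
Qed.

End Expectation.

(** * Conditional expectation given a sub-sigma-algebra *)

Section ConditionalExpectation.
Import HBSimple HBNNSimple.
Context {disp : measure_display} {Omega : measurableType disp} {R : realType}.
Variable Q : probability Omega R.
Implicit Types (X Y f : Omega -> R) (G : set (set Omega)).

Lemma measurable_wrt_preimage G X (B : set R) : sigma_algebra setT G ->
  measurable_wrt G X -> measurable B -> G (X @^-1` B).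
Proof.
move=> sG mX mB; have := mX measurableT B mB.
rewrite setTI => h; rewrite -(sigma_algebra_id sG); exact: h.
Qed.

Lemma measurable_wrt_sub G G' X : sigma_algebra setT G -> sigma_algebra setT G' ->
  G `<=` G' -> measurable_wrt G X -> measurable_wrt G' X.
Proof.
move=> sG sG' GG' mX _ B mB; rewrite setTI.
by apply: sub_sigma_algebra; apply: GG'; exact: measurable_wrt_preimage.
Qed.

Lemma measurable_wrt_measurable G X : sigma_algebra setT G ->
  G `<=` measurable -> measurable_wrt G X -> measurable_fun setT X.
Proof.
move=> sG GM mX _ B mB; rewrite setTI; apply: GM.
exact: measurable_wrt_preimage.
Qed.

Lemma measurable_wrt_indic G A : G A -> measurable_wrt G (\1_A : Omega -> R).
Proof.
move=> GA; apply: measurable_indic; exact: sub_sigma_algebra.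
Qed.

(** The image of Q under the identity map to the smaller measurable space
    dominates the image of the charge with density X; the Radon-Nikodym
    derivative there is measurable with respect to G. *)
Lemma condexp_exists G X : sigma_algebra setT G -> G `<=` measurable ->
  integrable_rv Q X -> exists Y, is_condexp Q G X Y.
Proof.
move=> sG GM iX.
pose idG : Omega -> g_sigma_algebraType G := id.
have mid : measurable_fun setT idG.
  by move=> _ A mA; rewrite setTI; apply: GM; rewrite -(sigma_algebra_id sG).
pose pid : {mfun Omega >-> g_sigma_algebraType G} := mfun_Sub (mem_set mid).
pose m : {sigma_finite_measure set (g_sigma_algebraType G) -> \bar R} :=
  distribution Q pid.
pose nu := measure_function_pushforward__canonical__charge_Charge
  (induced_charge iX) mid.
have nuE A : nu A = (\int[Q]_(w in A) (X w)%:E)%E by [].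
have mG A : measurable (A : set (g_sigma_algebraType G)) -> measurable (A : set Omega).
  by move=> mA; apply: GM; rewrite -(sigma_algebra_id sG).
have num : nu `<< m.
  apply/null_content_dominatesP => A mA A0.
  rewrite [LHS](nuE A); apply: null_set_integral => //; first exact: mG.
  by apply: measurable_funTS; exact: measurable_int iX.
have iY : m.-integrable setT (Radon_Nikodym nu m) by exact: Radon_Nikodym_integrable.
pose Y : Omega -> R := fine \o (Radon_Nikodym nu m).
have YE : EFin \o Y = Radon_Nikodym nu m.
  by apply/funext => w /=; rewrite fineK//; exact: Radon_Nikodym_fin_num.
have mY : measurable_wrt G Y.
  by apply/measurable_EFinP; rewrite YE; exact: measurable_int iY.
have iYQ : integrable_rv Q Y.
  apply/integrableP; split.
    by apply/measurable_EFinP; exact: measurable_wrt_measurable mY.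
  case/integrableP : iY => _.
  rewrite -YE (@ge0_integral_pushforward _ _ _ _ _ idG mid Q setT)//.
  by apply: measurableT_comp => //; exact/measurable_EFinP.
exists Y; split => // A GA; have mA : measurable (A : set (g_sigma_algebraType G)).
  exact: sub_sigma_algebra.
rewrite -[RHS](nuE A) [RHS](Radon_Nikodym_integral num mA) -YE.
rewrite (@integral_pushforward _ _ _ _ _ idG mid Q A)//.
- exact/measurable_EFinP.
- by apply: integrableS iYQ => //; exact: mG.
Qed.

Lemma condexp_mean_indic G X Y A : G `<=` measurable -> integrable_rv Q X ->
  is_condexp Q G X Y -> G A ->
  \int[Q]_w (\1_A w * (X w - Y w)) = 0.
Proof.
move=> GM iX [_ iY XY] GA; have mA := GM _ GA.
rewrite -mean_indic// RintegralB//.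
- by rewrite /Rintegral XY// subrr.
- exact: integrableS iX.
- exact: integrableS iY.
Qed.

(** Bounded G-measurable factors can be pulled through, by linearity from
    indicators of G-events and dominated convergence along simple functions. *)
Lemma condexp_mean G X Y f (c : R) : sigma_algebra setT G -> G `<=` measurable ->
  integrable_rv Q X -> is_condexp Q G X Y ->
  measurable_wrt G f -> (forall w, `|f w| <= c) ->
  \int[Q]_w (f w * X w) = \int[Q]_w (f w * Y w).
Proof.
move=> sG GM iX XY mf fc; have [_ iY _] := XY.
pose D w := X w - Y w.
have iD : integrable_rv Q D by exact: integrable_rvB.
have mfO (g : Omega -> R) : measurable_wrt G g ->
    measurable_fun (setT : set Omega) g.
  by move=> mg; exact: (measurable_wrt_measurable sG GM mg).
(* a nonnegative G-measurable function is a limit of G-simple ones *)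
have ge0 g b : measurable_wrt G g -> (forall w, 0 <= g w <= b) ->
    \int[Q]_w (g w * D w) = 0.
  move=> mg gb.
  pose T : measurableType _ := g_sigma_algebraType G.
  have mEg : measurable_fun (setT : set T) (EFin \o g : T -> \bar R).
    exact/measurable_EFinP.
  have g0 (w : T) : setT w -> (0 <= (EFin \o g) w)%E.
    by move=> _; rewrite lee_fin; case/andP: (gb w).
  pose sf n : {nnsfun T >-> R} := nnsfun_approx measurableT mEg n.
  pose s n (w : Omega) : R := sf n (w : T).
  have sg n w : 0 <= s n w <= g w.
    have -> : 0 <= s n w by rewrite /s; exact: fun_ge0.
    rewrite /= -lee_fin.
    by apply: le_trans (le_approx n g0 I); rewrite -nnsfun_approxE.
  have s0 n : \int[Q]_w (s n w * D w) = 0.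
    have e : (fun w => s n w * D w) = (fun w =>
        \sum_(y <- fset_set (range (s n))) y * (\1_(s n @^-1` [set y]) w * D w)).
      apply/funext => w; rewrite {1}/s (fimfunE (sf n)) fsbig_finite//= big_distrl/=.
      by apply: eq_bigr => y _; rewrite mulrA.
    have Gy y : G (s n @^-1` [set y]).
      apply: (@measurable_wrt_preimage G (s n)) => //; exact: (measurable_funP (sf n)).
    have iy y : integrable_rv Q (fun w => \1_(s n @^-1` [set y]) w * D w).
      apply: (@integrable_rvM_bounded _ _ _ _ 1) => //.
        by apply: mfO; exact: measurable_wrt_indic.
      by move=> w; rewrite ger0_norm ?indicE; case: (_ \in _).
    rewrite /= e mean_sum//; last by move=> y _; exact: integrable_rvZ.
    rewrite big1// => y _; rewrite meanZ//.
    by rewrite (@condexp_mean_indic G X Y) ?mulr0.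
  have : \int[Q]_w (s n w * D w) @[n --> \oo] --> \int[Q]_w (g w * D w).
    apply: (@mean_dominated _ _ _ _ _ _ (fun w => `|b| * `|D w|)).
    - move=> n; apply: measurable_funM; last exact: integrable_rv_measurable iD.
      by apply: mfO; exact: (measurable_funP (sf n)).
    - apply: measurable_funM; last exact: integrable_rv_measurable iD.
      exact: mfO.
    - by apply: integrable_rvZ; exact: integrable_rv_norm.
    - move=> n; apply: aeW => w; rewrite normrM ler_wpM2r//.
      have /andP[s0' sgw] := sg n w; have /andP[g0' gbw] := gb w.
      by rewrite ger0_norm// (le_trans sgw)// (le_trans gbw)// ler_norm.
    - apply: aeW => w; apply: cvgMl.
      exact: fine_cvg (cvg_nnsfun_approx measurableT mEg g0 (I : setT (w : T))).
  rewrite (_ : (fun n => _) = (fun=> 0)); last by apply/funext => n; exact: s0.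
  by move=> /(cvg_lim (@Rhausdorff R)) <-; rewrite lim_cst.
apply/eqP; rewrite -subr_eq0 -meanB; last 2 first.
- by apply: (integrable_rvM_bounded _ fc iX); exact: mfO.
- by apply: (integrable_rvM_bounded _ fc iY); exact: mfO.
(* shift f by its bound to reach the nonnegative case *)
rewrite (_ : Rintegral _ _ _ =
   \int[Q]_w ((f w + c) * D w - c * (\1_setT w * D w))); last first.
  by apply: eq_Rintegral => w _; rewrite /D indicT/=; ring.
have c0 (w : Omega) : `|c| = c by rewrite ger0_norm// (le_trans _ (fc w)).
have i1 : integrable_rv Q (fun w => \1_setT w * D w).
  by apply: eq_integrable iD => // w _ /=; rewrite indicT mul1r.
rewrite meanB//; last 2 first.
- apply: (@integrable_rvM_bounded _ _ _ _ (c + c)) => //.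
    by apply: measurable_funD => //; exact: mfO.
  by move=> w; rewrite (le_trans (ler_normD _ _))// lerD// (c0 w).
- exact: integrable_rvZ.
rewrite meanZ// (@condexp_mean_indic G X Y)//; last first.
  by case: sG => G0 GC _; have := GC _ G0; rewrite setD0.
rewrite mulr0 subr0 (ge0 _ (c + c))//.
  by apply: measurable_funD.
move=> w; have := fc w; rewrite ler_norml => {c0} /andP[h1 h2]; apply/andP; split; lra.
Qed.

End ConditionalExpectation.

(** * The Hilbert space of adapted square integrable families *)

Section AdaptedFamilies.
Context {disp : measure_display} {Omega : measurableType disp} {R : realType}.
Variables (Q : probability Omega R) (J : finType) (G : J -> set (set Omega)).
Hypothesis sG : forall j, sigma_algebra setT (G j).
Hypothesis GM : forall j, G j `<=` measurable.
Local Notation family := (J -> Omega -> R).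
Implicit Types (X Y Z : family) (C : set family).

Definition adapted X := forall j, measurable_wrt (G j) (X j).

Definition ip X Y (w : Omega) : R := \sum_j X j w * Y j w.

(** Each X j is measurable for its own sigma-algebra G j; for a process, j is
    a date and a coordinate. *)
Definition square_integrable X := adapted X /\ integrable_rv Q (ip X X).

(** The inner product of the space of square integrable families. *)
Definition mip X Y : R := \int[Q]_w ip X Y w.

Definition comb (a : R) X (b : R) Y : family := fun j w => a * X j w + b * Y j w.

Lemma adapted_measurable X j : adapted X -> measurable_fun setT (X j).
Proof. by move=> /(_ j); exact: measurable_wrt_measurable. Qed.

Lemma measurable_ip X Y : adapted X -> adapted Y -> measurable_fun setT (ip X Y).
Proof.
move=> aX aY; apply: measurable_sum => j.
by apply: measurable_funM; exact: adapted_measurable.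
Qed.

Lemma ipC X Y : ip X Y = ip Y X.
Proof. by apply/funext => w; apply: eq_bigr => j _; rewrite mulrC. Qed.

Lemma ip_ge0 X w : 0 <= ip X X w.
Proof. by apply: sumr_ge0 => j _; rewrite -expr2 sqr_ge0. Qed.

Lemma le_ip X j w : X j w ^+ 2 <= ip X X w.
Proof.
rewrite /ip (bigD1 j)//= expr2 lerDl.
by apply: sumr_ge0 => i _; rewrite -expr2 sqr_ge0.
Qed.

Lemma ip_combl a X b Y Z w : ip (comb a X b Y) Z w = a * ip X Z w + b * ip Y Z w.
Proof.
rewrite /ip !mulr_sumr -big_split/=; apply: eq_bigr => j _.
by rewrite mulrDl !mulrA.
Qed.

Lemma square_integrable_ip X Y : square_integrable X -> square_integrable Y ->
  integrable_rv Q (ip X Y).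
Proof.
move=> [aX iX] [aY iY].
apply: (@integrable_rv_le _ _ _ _ _ (fun w => ip X X w + ip Y Y w)).
- exact: measurable_ip.
- exact: integrable_rvD.
move=> w; rewrite [leRHS]ger0_norm ?addr_ge0 ?ip_ge0// /ip -big_split/=.
rewrite (le_trans (ler_norm_sum _ _ _))// ler_sum// => j _.
by rewrite ler_norml; apply/andP; split; nra.
Qed.

Lemma adapted_comb a X b Y : adapted X -> adapted Y -> adapted (comb a X b Y).
Proof.
by move=> aX aY j; apply: measurable_funD; apply: measurable_funM => //;
  [exact: aX|exact: aY].
Qed.

Lemma square_integrable_comb a X b Y : square_integrable X ->
  square_integrable Y -> square_integrable (comb a X b Y).
Proof.
move=> sX sY; have [aX iX] := sX; have [aY iY] := sY.
split; first exact: adapted_comb.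
rewrite (_ : ip _ _ = fun w => (a ^+ 2 * ip X X w + (2 * a * b) * ip X Y w)
   + b ^+ 2 * ip Y Y w).
  apply: integrable_rvD; last exact: integrable_rvZ.
  apply: integrable_rvD; apply: integrable_rvZ => //.
  exact: square_integrable_ip.
apply/funext => w; rewrite ip_combl [ip X _]ipC [ip Y _]ipC !ip_combl.
by rewrite [ip Y X]ipC; ring.
Qed.

Lemma mipC X Y : mip X Y = mip Y X. Proof. by rewrite /mip ipC. Qed.

Lemma mip_combl a X b Y Z : square_integrable X -> square_integrable Y ->
  square_integrable Z -> mip (comb a X b Y) Z = a * mip X Z + b * mip Y Z.
Proof.
move=> sX sY sZ; rewrite /mip -!meanZ; [|exact: square_integrable_ip..].
rewrite -meanD; [|exact/integrable_rvZ/square_integrable_ip..].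
by apply: eq_Rintegral => w _; exact: ip_combl.
Qed.

Lemma mip_comb a X b Y : square_integrable X -> square_integrable Y ->
  mip (comb a X b Y) (comb a X b Y) =
  a ^+ 2 * mip X X + 2 * a * b * mip X Y + b ^+ 2 * mip Y Y.
Proof.
move=> sX sY; have sXY := square_integrable_comb a b sX sY.
rewrite mip_combl// [mip X _]mipC [mip Y _]mipC !mip_combl// [mip Y X]mipC.
ring.
Qed.

Lemma mip_ge0 X : 0 <= mip X X.
Proof. by apply: Rintegral_ge0 => w _; exact: ip_ge0. Qed.

(** By monotone convergence the increasing limit is integrable, hence finite
    almost surely. *)
Lemma ae_le_of_bounded_mean (S : nat -> Omega -> R) (M : R) :
  (forall n, integrable_rv Q (S n)) -> (forall n w, 0 <= S n w) ->
  (forall w, nondecreasing_seq (S ^~ w)) -> (forall n, \int[Q]_w S n w <= M) ->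
  {ae Q, forall w, exists B, forall n, S n w <= B}.
Proof.
move=> iS S0 ndS SM.
pose L w := limn (fun n => (S n w)%:E).
have mS n : measurable_fun setT (fun w => (S n w)%:E) by exact: measurable_int (iS n).
have cS w : cvgn (fun n => (S n w)%:E).
  by apply: ereal_nondecreasing_is_cvgn => m n mn; rewrite lee_fin; exact: ndS.
have L0 w : (0 <= L w)%E by apply: lime_ge => //; apply: nearW => n; rewrite lee_fin.
have mL : measurable_fun setT L.
  by apply: (emeasurable_fun_cvg (fun n w => (S n w)%:E)) => // w _; exact: cS.
have iL : Q.-integrable setT L.
  apply/integrableP; split => //.
  under eq_integral => w _ do rewrite (gee0_abs (L0 w)).
  have -> : (\int[Q]_w L w = limn (fun n => \int[Q]_w (S n w)%:E))%E.
    apply: monotone_convergence => // [n w _|w _ m n mn]; rewrite lee_fin//.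
    exact: ndS.
  apply: (@le_lt_trans _ _ M%:E); last exact: ltry.
  apply: lime_le; last by apply: nearW => n; rewrite meanE// lee_fin.
  apply: ereal_nondecreasing_is_cvgn => m n mn.
  apply: ge0_le_integral => // w _; rewrite ?lee_fin//.
  exact: ndS.
apply: filterS (integrable_ae measurableT iL) => w /(_ I) fL.
exists (fine (L w)) => n; rewrite -lee_fin fineK//.
have ndE : nondecreasing_seq (fun n => (S n w)%:E).
  by move=> m p mp; rewrite lee_fin; exact: ndS.
rewrite /L (cvg_lim _ (ereal_nondecreasing_cvgn ndE))//.
by apply: ereal_sup_ubound; exists n.
Qed.

(** Iterating (a + b)^2 <= 2 a^2 + 2 b^2 along the increments bounds a total
    displacement by a weighted sum of squared increments, without square roots. *)
Lemma fast_increments (x : nat -> R) (n p : nat) :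
  (x (n + p)%N - x n) ^+ 2 <=
  \sum_(k < p) 2 ^+ k.+1 * (x (n + k).+1 - x (n + k)%N) ^+ 2.
Proof.
elim: p n => [|p IH] n; first by rewrite big_ord0 addn0 subrr expr0n.
rewrite big_ord_recl/= addn0 expr1.
have {IH} := IH n.+1; rewrite addSn -addnS => IH.
have -> : \sum_(i < p) 2 ^+ (bump 0 i).+1 *
    (x (n + bump 0 i).+1 - x (n + bump 0 i)%N) ^+ 2 =
   2 * \sum_(k < p) 2 ^+ k.+1 * (x (n.+1 + k).+1 - x (n.+1 + k)%N) ^+ 2.
  rewrite mulr_sumr; apply: eq_bigr => k _.
  by rewrite /bump/= add1n exprS -mulrA addnS addSn.
move: IH; set s := \sum_(_ < _) _ => IH.
apply: (@le_trans _ _ (2 * (x n.+1 - x n) ^+ 2 + 2 * (x (n + p.+1)%N - x n.+1) ^+ 2)).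
  rewrite -subr_ge0 [leRHS](_ : _ =
    ((x n.+1 - x n) - (x (n + p.+1)%N - x n.+1)) ^+ 2) ?sqr_ge0//; ring.
by rewrite lerD2l ler_pM2l.
Qed.

(** The increments are dominated by a geometric series of ratio 1/2. *)
Lemma cvg_of_fast_increments (x : nat -> R) (B : R) :
  (forall n, 4 ^+ n * (x n.+1 - x n) ^+ 2 <= B) -> cvgn x.
Proof.
move=> xB.
have B0 : 0 <= B by apply: le_trans (xB 0%N); rewrite mulr_ge0 ?sqr_ge0 ?exprn_ge0.
have le n : `|x n.+1 - x n| <= (1 + B) * 2^-1 ^+ n.
  rewrite -ler_sqr ?nnegrE ?mulr_ge0 ?addr_ge0 ?exprn_ge0//.
  rewrite real_normK ?num_real// exprMn exprAC.
  have -> : (2^-1 : R) ^+ 2 = 4^-1 by rewrite exprVn -natrX.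
  rewrite exprVn ler_pdivlMr ?exprn_gt0// mulrC (le_trans (xB n))//.
  nra.
have : cvgn (series (fun n => x n.+1 - x n)).
  apply: normed_cvg; apply: (series_le_cvg _ _ le) => [n|n|].
  - exact: normr_ge0.
  - by rewrite mulr_ge0 ?addr_ge0 ?exprn_ge0 ?invr_ge0.
  - apply: is_cvg_geometric_series; rewrite ger0_norm ?invr_ge0//.
    by rewrite invf_lt1// ltr1n.
move=> /cvg_ex[l xl]; apply/cvg_ex; exists (x 0%N + l).
have -> : x @ \oo = (fun n => x 0%N + series (fun n => x n.+1 - x n) n) @ \oo.
  congr (_ @ \oo); apply/funext => n.
  by rewrite /series/= telescope_sumr// addrC subrK.
exact: (cvgD (cvg_cst (x 0%N)) xl).
Qed.

Lemma cvgn_sum (I : Type) (s : seq I) (f : I -> nat -> R) (l : I -> R) :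
  (forall i, f i n @[n --> \oo] --> l i) ->
  \sum_(i <- s) f i n @[n --> \oo] --> \sum_(i <- s) l i.
Proof.
move=> fl; elim: s => [|i s IH].
  rewrite big_nil (_ : (fun n => _) = (fun=> 0)); first exact: cvg_cst.
  by apply/funext => n; rewrite big_nil.
rewrite big_cons (_ : (fun n => _) = (fun n => f i n + \sum_(j <- s) f j n)).
  exact: cvgD (fl i) IH.
by apply/funext => n; rewrite big_cons.
Qed.

Lemma cvgn_ip_dist (X : nat -> family) Y Z w :
  (forall j, X n j w @[n --> \oo] --> Y j w) ->
  ip (comb 1 Z (-1) (X n)) (comb 1 Z (-1) (X n)) w @[n --> \oo] -->
  ip (comb 1 Z (-1) Y) (comb 1 Z (-1) Y) w.
Proof.
move=> XY; apply: cvgn_sum => j.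
have cv : (comb 1 Z (-1) (X n) j w @[n --> \oo] --> comb 1 Z (-1) Y j w).
  by apply: cvgD; [exact: cvg_cst|apply: cvgM => //; exact: cvg_cst].
exact: (cvgM cv cv).
Qed.

Lemma ip_distC X Y w :
  ip (comb 1 X (-1) Y) (comb 1 X (-1) Y) w = ip (comb 1 Y (-1) X) (comb 1 Y (-1) X) w.
Proof. by apply: eq_bigr => j _; rewrite /comb; ring. Qed.

Lemma sum_half_le (n : nat) : \sum_(k < n) (2^-1 : R) ^+ k <= 2.
Proof.
have -> : \sum_(k < n) (2^-1 : R) ^+ k = 2 - 2 * 2^-1 ^+ n.
  elim: n => [|n IH]; first by rewrite big_ord0 expr0; ring.
  by rewrite big_ord_recr/= IH exprS; field.
by rewrite gerBl mulr_ge0// exprn_ge0.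
Qed.

(** Completeness, for sequences whose squared increments decay like 8^-n.
    The increments weighted by 4^n still have summable means, so they are
    bounded almost surely, and this forces pointwise convergence.  The limit is
    taken as an upper limit so that it stays adapted. *)
Lemma square_integrable_fast_cvg (X : nat -> family) (M : R) :
  (forall n, square_integrable (X n)) ->
  (forall n, mip (comb 1 (X n.+1) (-1) (X n)) (comb 1 (X n.+1) (-1) (X n))
             <= M * 8^-1 ^+ n) ->
  exists Y, square_integrable Y /\
    forall j, {ae Q, forall w, X n j w @[n --> \oo] --> Y j w}.
Proof.
move=> sX XM.
pose D n := comb 1 (X n.+1) (-1) (X n).
have sD n : square_integrable (D n) by exact: square_integrable_comb.
(* 4^k times 8^-k leaves a geometric bound of ratio 1/2 on the means *)
pose S n w := \sum_(k < n) 4 ^+ k * ip (D k) (D k) w.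
have M0 : 0 <= M.
  by have := XM 0%N; rewrite expr0 mulr1; apply: le_trans; exact: mip_ge0.
have term_ge0 k w : 0 <= 4 ^+ k * ip (D k) (D k) w.
  by rewrite mulr_ge0 ?ip_ge0 ?exprn_ge0.
have iS n : integrable_rv Q (S n).
  by apply: integrable_rv_sum => k _; apply: integrable_rvZ; case: (sD k).
have S0 n w : 0 <= S n w by exact: sumr_ge0.
have ndS w : nondecreasing_seq (S ^~ w).
  apply/nondecreasing_seqP => n.
  by rewrite /S big_ord_recr/= lerDl.
have SM n : \int[Q]_w S n w <= 2 * M.
  rewrite /S mean_sum; last first.
    by move=> k _; apply: integrable_rvZ; case: (sD k).
  apply: (@le_trans _ _ (\sum_(k < n) M * 2^-1 ^+ k)).
    apply: ler_sum => k _; rewrite meanZ; last by case: (sD k).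
    apply: (@le_trans _ _ (4 ^+ k * (M * 8^-1 ^+ k))).
      by rewrite ler_pM2l ?exprn_gt0//; exact: XM.
    rewrite mulrCA -exprMn (_ : 4 * 8^-1 = 2^-1 :> R)//.
    by field.
  by rewrite -mulr_sumr mulrC ler_wpM2r// sum_half_le.
have incr n j w : (X n.+1 j w - X n j w) ^+ 2 <= ip (D n) (D n) w.
  by have := le_ip (D n) j w; rewrite /D/= /comb mul1r mulN1r.
have cX : {ae Q, forall w, forall j, cvgn (fun n => X n j w)}.
  apply: filterS (ae_le_of_bounded_mean iS S0 ndS SM) => w [B SB] j.
  apply: (@cvg_of_fast_increments _ B) => n; apply: le_trans (SB n.+1).
  rewrite /S big_ord_recr/=; apply: (@le_trans _ _ (4 ^+ n * ip (D n) (D n) w)).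
    by rewrite ler_pM2l ?exprn_gt0.
  by rewrite lerDr; exact: (S0 n).
pose Y j w := fine (limn_esup (fun n => (X n j w)%:E)).
have XY : {ae Q, forall w j, X n j w @[n --> \oo] --> Y j w}.
  apply: filterS cX => w cX j; rewrite /Y.
  have cE : (X n j w)%:E @[n --> \oo] --> (limn (fun n => X n j w))%:E.
    by apply: cvg_EFin; [exact: nearW|exact: cX].
  by rewrite (cvg_limn_einf_sup cE).2; exact: cX.
have aY : adapted Y.
  move=> j; apply: (measurableT_comp (fine_measurable measurableT)).
  apply: measurable_fun_limn_esup => n; apply/measurable_EFinP.
  by case: (sX n) => + _; exact.
exists Y; split; last by move=> j; apply: filterS XY.
have [iYX _] : integrable_rv Q (ip (comb 1 Y (-1) (X 0%N)) (comb 1 Y (-1) (X 0%N))) /\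
    \int[Q]_w ip (comb 1 Y (-1) (X 0%N)) (comb 1 Y (-1) (X 0%N)) w
      <= #|J|%:R * (4 * M).
  apply: (@mean_fatou _ _ _ _ (fun n => ip (comb 1 (X n) (-1) (X 0%N))
     (comb 1 (X n) (-1) (X 0%N)))).
  - by move=> n; apply: square_integrable_ip; exact: square_integrable_comb.
  - by move=> n w; exact: ip_ge0.
  - by apply: measurable_ip; apply: adapted_comb => //; case: (sX 0%N).
  - by move=> w; exact: ip_ge0.
  - apply: filterS XY => w XY; rewrite ip_distC.
    rewrite (_ : (fun n => _) = (fun n => ip (comb 1 (X 0%N) (-1) (X n))
      (comb 1 (X 0%N) (-1) (X n)) w)); first exact: cvgn_ip_dist.
    by apply/funext => n; exact: ip_distC.
  - apply: nearW => n.
    have iR : integrable_rv Q (fun w => \sum_(j : J) 2 * S n w).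
      by apply: integrable_rv_sum => j _; exact: integrable_rvZ.
    apply: (@le_trans _ _ (\int[Q]_w (\sum_(j : J) 2 * S n w))); last first.
      rewrite mean_sum; last by move=> j _; exact: integrable_rvZ.
      rewrite sumr_const [leRHS]mulr_natl lerMn2r; apply/orP; right.
      rewrite meanZ// (_ : 4 * M = 2 * (2 * M)); last by ring.
      by rewrite ler_pM2l.
    apply: mean_le_ae => //.
      by apply: square_integrable_ip; exact: square_integrable_comb.
    apply: aeW => w; apply: ler_sum => j _; rewrite /comb !mul1r !mulN1r -expr2.
    have := fast_increments (fun n => X n j w) 0 n; rewrite !add0n => /le_trans; apply.
    rewrite /S mulr_sumr; apply: ler_sum => k _.
    rewrite add0n exprS -mulrA ler_pM2l// ler_pM ?sqr_ge0 ?exprn_ge0//.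
    by rewrite lerXn2r ?nnegrE// ler_nat.
split => //.
have sXY : square_integrable (comb 1 Y (-1) (X 0%N)).
  by split => //; apply: adapted_comb => //; case: (sX 0%N).
have -> : Y = comb 1 (comb 1 Y (-1) (X 0%N)) 1 (X 0%N).
  by apply/funext => j; apply/funext => w; rewrite /comb; ring.
by case: (square_integrable_comb 1 1 sXY (sX 0%N)).
Qed.

End AdaptedFamilies.

(** * Projection on a closed convex cone *)

Section ConeSeparation.
Context {disp : measure_display} {Omega : measurableType disp} {R : realType}.
Variables (Q : probability Omega R) (J : finType) (G : J -> set (set Omega)).
Hypothesis sG : forall j, sigma_algebra setT (G j).
Hypothesis GM : forall j, G j `<=` measurable.
Local Notation family := (J -> Omega -> R).
Local Notation L2 := (square_integrable Q G).
Local Notation mip := (mip Q).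
Implicit Types (X Y Z : family).

Variable C : set family.
Hypothesis C0 : C (fun _ _ => 0).
Hypothesis C_comb : forall a b X Y, 0 <= a -> 0 <= b -> C X -> C Y -> C (comb a X b Y).
Hypothesis C_closed : forall (X : nat -> family) Y, (forall n, C (X n)) -> adapted G Y ->
  (forall j, {ae Q, forall w, X n j w @[n --> \oo] --> Y j w}) -> C Y.

(** A minimising sequence with errors 8^-n is fast Cauchy by the parallelogram
    identity, since the midpoints stay in the cone; Fatou's lemma bounds the
    distance to its limit. *)
Lemma cone_projection X : L2 X -> exists Y, [/\ C Y, L2 Y &
  forall Z, C Z -> L2 Z ->
    mip (comb 1 X (-1) Y) (comb 1 X (-1) Y) <= mip (comb 1 X (-1) Z) (comb 1 X (-1) Z)].
Proof.
move=> sX.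
pose q Z := mip (comb 1 X (-1) Z) (comb 1 X (-1) Z).
pose V := [set q Z | Z in [set Z | C Z /\ L2 Z]].
have sZ0 : L2 (fun _ _ => 0).
  split; first by move=> j; exact: measurable_cst.
  rewrite (_ : ip _ _ = fun=> 0); first exact: integrable_rv_cst.
  by apply/funext => w; rewrite /ip big1// => j _; rewrite mul0r.
have infV : has_inf V.
  split; first by exists (q (fun _ _ => 0)); exists (fun _ _ => 0).
  by exists 0 => _ [Z _ <-]; exact: mip_ge0.
pose delta := inf V.
have delta_le Z : C Z -> L2 Z -> delta <= q Z.
  by move=> CZ sZ; apply: ge_inf; [case: infV|exists Z].
have /choice[c cP] : forall n : nat, exists Z, [/\ C Z, L2 Z & q Z < delta + 8^-1 ^+ n].
  move=> n; have [|_ [Z [CZ sZ] <-] qZ] := @inf_adherent _ V (8^-1 ^+ n) _ infV.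
    by rewrite exprn_gt0.
  by exists Z.
have Cc n : C (c n) by case: (cP n).
have sc n : L2 (c n) by case: (cP n).
have qc n : q (c n) <= delta + 8^-1 ^+ n by case: (cP n) => _ _ /ltW.
(* the difference of two iterates is controlled by the excess of their midpoint *)
have parallelogram n : mip (comb 1 (c n.+1) (-1) (c n)) (comb 1 (c n.+1) (-1) (c n))
    <= 4 * 8^-1 ^+ n.
  pose U := comb 1 X (-1) (c n); pose W := comb 1 X (-1) (c n.+1).
  have sU : L2 U by exact: square_integrable_comb.
  have sW : L2 W by exact: square_integrable_comb.
  have -> : comb 1 (c n.+1) (-1) (c n) = comb 1 U (-1) W.
    by apply/funext => j; apply/funext => w; rewrite /U /W /comb; ring.
  have : delta <= q (comb 2^-1 (c n) 2^-1 (c n.+1)).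
    by apply: delta_le; [exact: C_comb|exact: square_integrable_comb].
  have -> : q (comb 2^-1 (c n) 2^-1 (c n.+1)) =
      mip (comb 2^-1 U 2^-1 W) (comb 2^-1 U 2^-1 W).
    by congr mip; apply/funext => j; apply/funext => w; rewrite /U /W /comb; field.
  rewrite (mip_comb sG GM 1 (-1) sU sW) (mip_comb sG GM 2^-1 2^-1 sU sW).
  have := qc n; have := qc n.+1; rewrite /q -/U -/W exprS.
  have : 0 <= (8^-1 : R) ^+ n by rewrite exprn_ge0.
  set e := 8^-1 ^+ n; set uu := mip U U; set ww := mip W W; set uw := mip U W.
  clear => h1 h2 h3 h4; rewrite !expr2; lra.
have [Y [sY cY]] := square_integrable_fast_cvg sG GM sc parallelogram.
have CY : C Y by apply: (C_closed Cc) => //; case: sY.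
exists Y; split => // Z CZ sZ; apply: (le_trans _ (delta_le _ CZ sZ)).
apply/ler_addgt0Pr => e e0.
suff [] : integrable_rv Q (ip (comb 1 X (-1) Y) (comb 1 X (-1) Y)) /\
  mip (comb 1 X (-1) Y) (comb 1 X (-1) Y) <= delta + e by [].
apply: (@mean_fatou _ _ _ _ (fun n => ip (comb 1 X (-1) (c n)) (comb 1 X (-1) (c n)))).
- by move=> n; apply: square_integrable_ip => //; exact: square_integrable_comb.
- by move=> n w; exact: ip_ge0.
- have aXY : adapted G (comb 1 X (-1) Y) by apply: adapted_comb; [case: sX|case: sY].
  exact: (measurable_ip sG GM).
- by move=> w; exact: ip_ge0.
- have cY' : {ae Q, forall w, forall j, c n j w @[n --> \oo] --> Y j w}.
    exact: filter_forall.
  by apply: filterS cY' => w; exact: cvgn_ip_dist.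
- have : (8^-1 : R) ^+ n @[n --> \oo] --> 0.
    by apply: cvg_expr; rewrite ger0_norm// invf_lt1// ltr1n.
  move=> /cvgrPdist_lt/(_ e e0); apply: filterS => n.
  rewrite sub0r normrN ger0_norm ?exprn_ge0// => /ltW h.
  by apply: (le_trans (qc n)); rewrite lerD2l.
Qed.

(** Y is the residual of the projection p of X.  Moving from p in a direction
    Z of the cone gives <Y, Z> <= 0, and shrinking p gives <Y, p> >= 0, whence
    <Y, X> >= |Y|^2; this is positive, as otherwise X = p almost surely. *)
Lemma cone_separation X : L2 X -> ~ C X -> exists Y, [/\ L2 Y, 0 < mip Y X &
  forall Z, C Z -> L2 Z -> mip Y Z <= 0].
Proof.
move=> sX nCX; have [p [Cp sp pmin]] := cone_projection sX.
pose Y := comb 1 X (-1) p; have sY : L2 Y by exact: square_integrable_comb.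
have var Z t : C (comb 1 p t Z) -> L2 Z -> 2 * t * mip Y Z <= t ^+ 2 * mip Z Z.
  move=> CZ sZ; have := pmin _ CZ (square_integrable_comb sG GM 1 t sp sZ).
  have -> : comb 1 X (-1) (comb 1 p t Z) = comb 1 Y (- t) Z.
    by apply/funext => j; apply/funext => w; rewrite /Y /comb; ring.
  rewrite -/Y (mip_comb sG GM 1 (- t) sY sZ); set a := mip Y Y; set b := mip Y Z; set c := mip Z Z.
  by clear => h; lra.
have le0 Z : C Z -> L2 Z -> mip Y Z <= 0.
  move=> CZ sZ; rewrite leNgt; apply/negP => YZ.
  have ZZ := mip_ge0 Q Z.
  (* a step for which the gain 2 t <Y, Z> exceeds the cost t^2 |Z|^2 *)
  pose t := mip Y Z / (1 + mip Z Z).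
  have den : 0 < 1 + mip Z Z by rewrite ltr_pwDl.
  have t0 : 0 < t by rewrite divr_gt0.
  have := var Z t (C_comb ler01 (ltW t0) Cp CZ) sZ.
  have -> : mip Y Z = t * (1 + mip Z Z) by rewrite /t divfK// gt_eqF.
  rewrite expr2; set z := mip Z Z in ZZ *.
  have tt : 0 < t * t by rewrite mulr_gt0.
  move=> h; have : t * t * (2 + z) <= 0 by move: h; clear; lra.
  by rewrite leNgt mulr_gt0// ltr_pwDl.
have Yp : 0 <= mip Y p.
  have C' t : t <= 1 -> C (comb 1 p (- t) p).
    move=> t1; have := C_comb (_ : 0 <= 1 - t) ler01 Cp C0; rewrite subr_ge0 => /(_ t1).
    by congr C; apply/funext => j; apply/funext => w; rewrite /comb; ring.
  rewrite leNgt; apply/negP => Yp0.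
  have pp := mip_ge0 Q p.
  have := var p (- 1 * (Num.min 1 (- mip Y p / (1 + mip p p)))) .
  set t := Num.min _ _.
  have den : 0 < 1 + mip p p by rewrite ltr_pwDl.
  have t1 : t <= 1 by rewrite ge_min lexx.
  have t0 : 0 < t by rewrite lt_min ltr01 divr_gt0// oppr_gt0.
  have tle : t * (1 + mip p p) <= - mip Y p.
    by rewrite -ler_pdivlMr// ge_min lexx orbT.
  rewrite mulN1r => /(_ (C' _ t1) sp).
  move: tle Yp0 pp t0; set y := mip Y p; set z := mip p p; clear.
  by move=> *; nra.
have XE : X = comb 1 Y 1 p.
  by apply/funext => j; apply/funext => w; rewrite /Y /comb; ring.
exists Y; split => //.
rewrite XE mipC (mip_combl sG GM)// !mul1r [mip p Y]mipC ltr_wpDr//.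
rewrite lt_neqAle mip_ge0 andbT; apply/negP => /eqP/esym YY0.
have /mean_eq0 : integrable_rv Q (ip Y Y) by exact: square_integrable_ip.
move=> /(_ (aeW _ (ip_ge0 Y))); rewrite -/(mip Y Y) YY0 => /(_ (lexx _)) ae0.
apply: nCX; apply: (@C_closed (fun=> p)) => //; first by case: sX.
move=> j; apply: filterS ae0 => w Yw0.
suff -> : X j w = p j w by exact: cvg_cst.
apply/eqP; rewrite -subr_eq0 -sqrf_eq0 eq_le sqr_ge0 andbT -Yw0.
by have := le_ip Y j w; rewrite /Y /comb mul1r mulN1r.
Qed.

End ConeSeparation.

(** * Polyhedral cones and their polars *)

Section Duality.
Context {R : realType} {d : nat}.
Implicit Types (x y : 'rV[R]_d) (C : set 'rV[R]_d).

Lemma dotC x y : dot x y = dot y x.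
Proof. by apply: eq_bigr => i _; rewrite mulrC. Qed.

Lemma dotDl x y z : dot (x + y) z = dot x z + dot y z.
Proof.
by rewrite /dot -big_split/=; apply: eq_bigr => i _; rewrite mxE mulrDl.
Qed.

Lemma dotZl (a : R) x y : dot (a *: x) y = a * dot x y.
Proof. by rewrite /dot mulr_sumr; apply: eq_bigr => i _; rewrite mxE mulrA. Qed.

Lemma dotNl x y : dot (- x) y = - dot x y.
Proof. by rewrite -scaleN1r dotZl mulN1r. Qed.

Lemma dotBl x y z : dot (x - y) z = dot x z - dot y z.
Proof. by rewrite dotDl dotNl. Qed.

Lemma dot0l x : dot 0 x = 0.
Proof. by rewrite -(scale0r (0 : 'rV[R]_d)) dotZl mul0r. Qed.

Lemma dot_suml (I : Type) (s : seq I) (p : pred I) (f : I -> 'rV[R]_d) y :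
  dot (\sum_(i <- s | p i) f i) y = \sum_(i <- s | p i) dot (f i) y.
Proof. by apply: (big_morph (fun x => dot x y)) => [x z|]; rewrite ?dotDl ?dot0l. Qed.

Lemma dot_delta (i : 'I_d) y : dot (delta_mx 0 i) y = y 0 i.
Proof.
rewrite /dot (bigD1 i)//= mxE !eqxx mul1r big1 ?addr0// => j ji.
by rewrite mxE (negbTE ji) andbF mul0r.
Qed.

Lemma dot_ge0 x : 0 <= dot x x.
Proof. by apply: sumr_ge0 => i _; rewrite -expr2 sqr_ge0. Qed.

Lemma sqr_le_dot x i : x 0 i ^+ 2 <= dot x x.
Proof.
rewrite /dot (bigD1 i)//= expr2 lerDl.
by apply: sumr_ge0 => j _; rewrite -expr2 sqr_ge0.
Qed.

Lemma cone0 (X : nat -> 'rV[R]_d) : cone X 0.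
Proof. by exists 0%N, (fun=> 0); split => //; rewrite big_ord0. Qed.

Lemma cone_gen (X : nat -> 'rV[R]_d) n : cone X (X n).
Proof.
exists n.+1, (fun k => (k == n)%:R); split => [k|]; first by rewrite ler0n.
rewrite big_ord_recr/= eqxx scale1r big1 ?add0r// => k _.
by rewrite ltn_eqF// scale0r.
Qed.

(** The two combinations are padded with zeros to a common length. *)
Lemma cone_comb (X : nat -> 'rV[R]_d) (a b : R) x y : 0 <= a -> 0 <= b ->
  cone X x -> cone X y -> cone X (a *: x + b *: y).
Proof.
move=> a0 b0 [N [u [u0 ->]]] [M [v [v0 ->]]].
have pad (w : nat -> R) L L' : (L <= L')%N ->
    \sum_(n < L) w n *: X n = \sum_(n < L') (if (n < L)%N then w n else 0) *: X n.
  move=> LL'; rewrite (big_ord_widen L' (fun n => w n *: X n))// big_mkcond/=.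
  by apply: eq_bigr => n _; case: ifP => //; rewrite scale0r.
rewrite (pad u N (N + M)%N) ?leq_addr// (pad v M (N + M)%N) ?leq_addl//.
exists (N + M)%N, (fun n => a * (if (n < N)%N then u n else 0) +
  b * (if (n < M)%N then v n else 0)); split.
  by move=> n; rewrite addr_ge0// mulr_ge0//; case: ifP.
rewrite !scaler_sumr -big_split/=; apply: eq_bigr => n _.
by rewrite scalerDl !scalerA.
Qed.

Lemma polar_cone (X : nat -> 'rV[R]_d) y :
  (forall n, 0 <= dot (X n) y) -> polar (cone X) y.
Proof.
move=> Xy x [N [a [a0 ->]]]; rewrite dot_suml; apply: sumr_ge0 => n _.
by rewrite dotZl mulr_ge0.
Qed.

(** The unit vectors are in C. *)
Lemma polar_orthant C y : @orthant R d `\ 0 `<=` interior C ->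
  polar C y -> orthant y.
Proof.
move=> CC Cy i; rewrite -dot_delta; apply: Cy.
apply: (interior_subset (CC _ _)); split => [j|]; first by rewrite mxE ler0n.
move=> /= /matrixP/(_ 0 i); rewrite !mxE !eqxx/= => /eqP.
by rewrite oner_eq0.
Qed.

End Duality.

(** * Equivalent probabilities and convergence in measure *)

Section AlmostSurely.
Context {disp : measure_display} {Omega : measurableType disp} {R : realType}.
Implicit Types P Q : probability Omega R.

Lemma dominated_ae P Q (p : Omega -> Prop) : Q `<< P ->
  {ae P, forall w, p w} -> {ae Q, forall w, p w}.
Proof.
move=> QP [A [mA A0 pA]]; exists A; split => //.
by apply/(measure0_null_setP _ mA)/QP/(measure0_null_setP _ mA).
Qed.

End AlmostSurely.

Section ConvergenceInMeasure.
Context {disp : measure_display} {Omega : measurableType disp} {R : realType}.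
Variable P : probability Omega R.

(** The indicators of the exceedance events converge to 0 almost surely and
    are bounded by 1. *)
Lemma ae_cvg_in_measure (X : nat -> Omega -> R) (eps : R) : 0 < eps ->
  (forall n, measurable_fun setT (X n)) ->
  {ae P, forall w, X n w @[n --> \oo] --> 0} ->
  P [set w | eps < X n w] @[n --> \oo] --> 0%E.
Proof.
move=> e0 mX X0.
have mA n : measurable [set w | eps < X n w].
  rewrite (_ : [set w | _] = X n @^-1` `]eps, +oo[%classic).
    by rewrite -[X in measurable X]setTI; exact: mX.
  by apply/seteqP; split => w /=; rewrite in_itv/= andbT.
have PE n : P [set w | eps < X n w] = (\int[P]_w \1_[set w | eps < X n w] w)%:E.
  rewrite -meanE; first by rewrite integral_indic// setIT.
  by apply: integrable_indic => //; rewrite -ge0_fin_numE// fin_num_measure.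
under eq_fun do rewrite PE.
apply: cvg_EFin; first exact: nearW.
rewrite -[X in _ --> X](mean_cst P 0).
apply: (@mean_dominated _ _ _ _ _ _ (cst 1)) => //.
- by move=> n; exact: measurable_indic.
- exact: integrable_rv_cst.
- by move=> n; apply: aeW => w; rewrite indicE /=; case: (_ \in _); rewrite ?normr1 ?normr0.
apply: filterS X0 => w /cvgrPdist_lt/(_ _ e0) Xe.
apply: cvg_near_cst; apply: filterS Xe => n; rewrite sub0r normrN => Xe.
rewrite indicE memNset//=; apply/negP; rewrite -leNgt.
by rewrite (le_trans (ler_norm _))// ltW.
Qed.

End ConvergenceInMeasure.

(** * The cone of super-attainable claims *)

Section AttainableClaims.
Context {disp : measure_display} {Omega : measurableType disp} {R : realType}.
Context {d T : nat}.
Variables (P : probability Omega R) (F : 'I_T.+1 -> set (set Omega)).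
Variable K : cone_process Omega R d T.
Hypothesis FP : filtration P F.
Hypothesis KP : in_calK P F K.

Local Notation idx := ('I_T.+1 * 'I_d)%type.
Local Notation proc := (process Omega R d T).
Local Notation adaptedp := (L0_process P (fun=> setT) F).
Local Notation A := (attainable_s P F 0 K).

(** Processes are viewed as families of real variables indexed by a date and
    a coordinate, to which the Hilbert space arguments apply. *)
Definition coords (X : proc) : idx -> Omega -> R := fun j w => X j.1 w 0 j.2.

Definition process_of (Y : idx -> Omega -> R) : proc :=
  fun t w => \row_i Y (t, i) w.

Definition date_filtration (j : idx) : set (set Omega) := F j.1.

Lemma process_ofK : cancel process_of coords.
Proof.
by move=> Y; apply/funext => -[t i]; apply/funext => w; rewrite /coords mxE.
Qed.

Lemma ip_coords (X Y : proc) w : ip (coords X) (coords Y) w = \sum_t dot (X t w) (Y t w).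
Proof. by rewrite /ip /dot pair_bigA; apply: eq_bigr => j _. Qed.

Lemma filtration_sigma t : sigma_algebra setT (F t).
Proof. by case: FP. Qed.

Lemma filtration_measurable t : F t `<=` measurable.
Proof. by case: FP => _ mono <- _; apply: mono; rewrite -ltnS. Qed.

Lemma filtration_le (s t : 'I_T.+1) : (s <= t)%N -> F s `<=` F t.
Proof. by case: FP => _ mono _ _; exact: mono. Qed.

Lemma date_sigma j : sigma_algebra setT (date_filtration j).
Proof. exact: filtration_sigma. Qed.

Lemma date_measurable j : date_filtration j `<=` measurable.
Proof. exact: filtration_measurable. Qed.

Lemma adapted_coords (X : proc) : adaptedp X <-> adapted date_filtration (coords X).
Proof.
split=> [aX [t i]|aX t]; first by case: (aX t) => + _; exact.
by split; [move=> i; exact: (aX (t, i))|exact: aeW].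
Qed.

Lemma adapted_process_of Y : adapted date_filtration Y -> adaptedp (process_of Y).
Proof. by move=> aY; apply/adapted_coords; rewrite process_ofK. Qed.

Lemma adapted_le (X : proc) (s t : 'I_T.+1) (i : 'I_d) : adaptedp X -> (s <= t)%N ->
  measurable_wrt (F t) (fun w => X s w 0 i).
Proof.
move=> aX st; apply: (measurable_wrt_sub (filtration_sigma s) (filtration_sigma t)).
  exact: filtration_le.
by case: (aX s) => + _; exact.
Qed.

Lemma adapted_process_comb (a b : R) (X Y : proc) : adaptedp X -> adaptedp Y ->
  adaptedp (fun t w => a *: X t w + b *: Y t w).
Proof.
move=> /adapted_coords aX /adapted_coords aY; apply/adapted_coords.
rewrite (_ : coords _ = comb a (coords X) b (coords Y)); first exact: adapted_comb.
by apply/funext => j; apply/funext => w; rewrite /coords /comb !mxE.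
Qed.

Lemma adapted_process0 : adaptedp (fun _ _ => 0 : 'rV[R]_d).
Proof.
apply/adapted_coords => j; rewrite (_ : coords _ _ = cst 0); first exact: measurable_cst.
by apply/funext => w; rewrite /coords mxE.
Qed.

Lemma adapted_portfolio (X : proc) : adaptedp X -> adaptedp (portfolio 0 X).
Proof.
move=> aX; apply/adapted_coords => -[t i].
rewrite (_ : coords _ _ = fun w =>
    \sum_(s < T.+1) (if (s <= t)%N then X s w 0 i else 0)).
  apply: measurable_sum => s; case: (boolP (s <= t)%N) => st; last exact: measurable_cst.
  exact: adapted_le.
apply/funext => w; by rewrite /coords /portfolio add0r/= summxE big_mkcond.
Qed.

Lemma solvency_cone t : {ae P, forall w, K t w 0 /\ forall (a b : R) x y,
  0 <= a -> 0 <= b -> K t w x -> K t w y -> K t w (a *: x + b *: y)}.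
Proof.
have [[X [aX XK]] _] := KP; apply: filterS (XK t) => w [_ _ ->].
by split; [exact: cone0|move=> a b x y; exact: cone_comb].
Qed.

Lemma solvency_orthant t : {ae P, forall w, polar (K t w) `<=` @orthant R d}.
Proof.
by case: KP => _ /(_ t); apply: filterS => w Kint y; exact: polar_orthant.
Qed.

Lemma attainableE (theta : proc) : A theta <-> adaptedp theta /\ exists2 xi, calA P F K xi &
  forall t, {ae P, forall w, K t w (portfolio 0 xi t w - theta t w)}.
Proof.
split=> [[at_ [_ [xi Axi <-] h]]|[at_ [xi Axi h]]]; split => //; first by exists xi.
by exists (portfolio 0 xi) => //; exists xi.
Qed.

Lemma portfolio_comb (a b : R) (xi xi' : proc) t w :
  portfolio 0 (fun t w => a *: xi t w + b *: xi' t w) t w =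
  a *: portfolio 0 xi t w + b *: portfolio 0 xi' t w.
Proof. by rewrite /portfolio !add0r !scaler_sumr -big_split. Qed.

Lemma attainable_comb (a b : R) (X Y : proc) : 0 <= a -> 0 <= b -> A X -> A Y ->
  A (fun t w => a *: X t w + b *: Y t w).
Proof.
move=> a0 b0 /attainableE[aX [xi [axi Kxi] XK]] /attainableE[aY [xi' [axi' Kxi'] YK]].
apply/attainableE; split; first exact: adapted_process_comb.
exists (fun t w => a *: xi t w + b *: xi' t w).
  split; first exact: adapted_process_comb.
  move=> t; apply: filterS3 (solvency_cone t) (Kxi t) (Kxi' t) => w [_ h] h1 h2.
  by rewrite opprD -!scalerN; exact: h.
move=> t; apply: filterS3 (solvency_cone t) (XK t) (YK t) => w [_ h] h1 h2.
rewrite portfolio_comb (_ : _ - _ = a *: (portfolio 0 xi t w - X t w) +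
   b *: (portfolio 0 xi' t w - Y t w)); first exact: h.
by rewrite !scalerBr opprD addrACA.
Qed.

Lemma attainable_ae (X Y : proc) : A X -> adaptedp Y ->
  (forall t, {ae P, forall w, X t w = Y t w}) -> A Y.
Proof.
move=> /attainableE[aX [xi Axi XK]] aY XY; apply/attainableE; split => //.
by exists xi => // t; apply: filterS2 (XK t) (XY t) => w + <-.
Qed.

Lemma calA0 : calA P F K (fun _ _ => 0 : 'rV[R]_d).
Proof.
split; first exact: adapted_process0.
by move=> t; apply: filterS (solvency_cone t) => w [h _]; rewrite oppr0.
Qed.

Lemma attainable_portfolio xi : calA P F K xi -> A (portfolio 0 xi).
Proof.
move=> Axi; apply/attainableE; split; first by apply: adapted_portfolio; case: Axi.
exists xi => // t; apply: filterS (solvency_cone t) => w [h _].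
by rewrite subrr.
Qed.

(** The zero portfolio dominates - k. *)
Lemma attainable_sub (k : proc) : adaptedp k -> (forall t, {ae P, forall w, K t w (k t w)}) ->
  A (fun t w => - k t w).
Proof.
move=> ak Kk; apply/attainableE; split.
  have := adapted_process_comb (-1) 0 ak ak; congr adaptedp.
  by apply/funext => t; apply/funext => w; rewrite scaleN1r scale0r addr0.
exists (fun _ _ => 0); first exact: calA0.
move=> t; apply: filterS (Kk t) => w.
by rewrite /portfolio add0r big1// sub0r opprK.
Qed.

Lemma attainable0 : A (fun _ _ => 0 : 'rV[R]_d).
Proof.
have := attainable_portfolio calA0; congr (attainable_s _ _ _ _ _).
by apply/funext => t; apply/funext => w; rewrite /portfolio add0r big1.
Qed.

Hypothesis KC : closed_in_measure P A.

(** Closedness in measure yields a version of the limit in A^s(K); as the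
    limit is adapted it is itself in A^s(K). *)
Lemma attainable_closed (X : nat -> proc) (Y : proc) : (forall n, A (X n)) -> adaptedp Y ->
  (forall j, {ae P, forall w, coords (X n) j w @[n --> \oo] --> coords Y j w}) -> A Y.
Proof.
move=> AX aY XY.
have aX n : adaptedp (X n) by case/attainableE: (AX n).
have [|||Y' AY' YY'] := KC (vn := X) (v := Y) => //.
- move=> t; split; last exact: aeW.
  have -> : @measurable _ Omega = F ord_max by case: FP.
  by move=> i; apply: adapted_le => //; rewrite -ltnS.
- move=> eps e0; apply: ae_cvg_in_measure => // [n|].
    apply: measurable_sum => t; apply: measurableT_comp.
      by apply: continuous_measurable_fun; exact: sqrt_continuous.
    apply: measurable_sum => i; have m : measurable_fun setT (fun w => (X n t w - Y t w) 0 i).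
      rewrite (_ : (fun w => _) = fun w => coords (X n) (t, i) w - coords Y (t, i) w).
        by apply: measurable_funB; apply: (adapted_measurable date_sigma date_measurable);
          exact/adapted_coords.
      by apply/funext => w; rewrite !mxE.
    exact: measurable_funM.
  have cv : {ae P, forall w, forall j, coords (X n) j w @[n --> \oo] --> coords Y j w}.
    exact: filter_forall.
  apply: filterS cv => w cv.
  rewrite [X in _ --> X](_ : 0 = \sum_(t < T.+1) Num.sqrt (0 : R)); last first.
    by rewrite big1// => t _; rewrite sqrtr0.
  apply: cvgn_sum => t.
  suff : dot (X n t w - Y t w) (X n t w - Y t w) @[n --> \oo] --> (0 : R).
    by move=> h; exact: (cvg_comp _ _ h (@sqrt_continuous R 0)).
  rewrite [X in _ --> X](_ : 0 = \sum_(i < d) (0 : R) * 0); last first.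
    by rewrite big1// => i _; rewrite mulr0.
  apply: cvgn_sum => i.
  have cv' : (X n t w - Y t w) 0 i @[n --> \oo] --> (0 : R).
    rewrite (_ : (fun n => _) = (fun n => coords (X n) (t, i) w - coords Y (t, i) w)).
      rewrite -(subrr (coords Y (t, i) w)); apply: cvgB; first exact: cv.
      exact: cvg_cst.
    by apply/funext => n; rewrite !mxE.
  exact: cvgM.
apply: (attainable_ae AY') => // t; apply: filterS (YY' t) => w //.
Qed.

Hypothesis NAK : NA P F K.

(** Follow the hedging strategy up to date t, give up there the excess k of the
    portfolio over the claim, and stop trading.  The terminal wealth is the
    claim itself, which is nonnegative and must vanish. *)
Lemma no_arbitrage_claim (t : 'I_T.+1) (i : 'I_d) (B : set Omega) : F t B ->
  A (fun s w => if s == t then \1_B w *: delta_mx 0 i else 0) -> P B = 0%E.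
Proof.
move=> FB /attainableE[ath [xi [axi Kxi] XK]].
pose k : proc := fun s w => portfolio 0 xi s w -
  (if s == t then \1_B w *: delta_mx 0 i else 0).
have ak : adaptedp k.
  have := adapted_process_comb 1 (-1) (adapted_portfolio axi) ath; congr adaptedp.
  by apply/funext => s; apply/funext => w; rewrite scale1r scaleN1r.
pose eta : proc := fun s w => if (s < t)%N then xi s w
  else if s == t then xi s w - k s w else 0.
have axik : adaptedp (fun s w => xi s w - k s w).
  have := adapted_process_comb 1 (-1) axi ak; congr adaptedp.
  by apply/funext => s; apply/funext => w; rewrite scale1r scaleN1r.
have aeta : adaptedp eta.
  move=> s; rewrite /eta; case: ltnP => _; first exact: axi.
  case: eqP => _; last exact: adapted_process0.
  exact: axik.
have Aeta : calA P F K eta.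
  split => // s; rewrite /eta; case: ltnP => _; first exact: Kxi.
  case: eqP => _; last by apply: filterS (solvency_cone s) => w [h _]; rewrite oppr0.
  apply: filterS3 (solvency_cone s) (Kxi s) (XK s) => w [_ h] h1 h2.
  rewrite opprB addrC -[- xi s w]scale1r -[k s w]scale1r; exact: h.
have portE w : portfolio 0 eta ord_max w = \1_B w *: delta_mx 0 i.
  have -> : portfolio 0 eta ord_max w = portfolio 0 xi t w - k t w.
    rewrite /portfolio !add0r (bigID (fun s : 'I_T.+1 => (s <= t)%N))/=.
    rewrite [X in _ + X]big1 ?addr0; last first.
      move=> s /andP[_]; rewrite -ltnNge => ts.
      by rewrite /eta ltnNge ltnW//= gt_eqF.
    rewrite (bigD1 t)/=; last by rewrite leqnn andbT -ltnS.
    rewrite [in RHS](bigD1 t)//= {1}/eta ltnn eqxx.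
    rewrite -!addrA; congr (_ + _); rewrite addrC; congr (_ + _).
    apply: eq_big => s.
      by rewrite -ltnS ltn_ord.
    by move=> /andP[/andP[_ st] nst]; rewrite /eta ltn_neqAle nst st.
  by rewrite /k eqxx opprB addrC subrK.
have : (attainable_at P F 0 K ord_max `&` L0 P (fun=> orthant) measurable)
    (portfolio 0 eta ord_max).
  split; first by exists (portfolio 0 eta) => //; exists eta.
  split; last first.
    apply: aeW => w j; rewrite portE !mxE mulr_ge0// ?indicE ?ler0n//.
  have -> : @measurable _ Omega = F ord_max by case: FP.
  by move=> j; case: (adapted_portfolio aeta ord_max) => + _; exact.
rewrite NAK => -[_ h].
have mB : measurable B by exact: filtration_measurable FB.
apply/(negligibleP _ mB); apply: negligibleS h => w Bw /= /matrixP/(_ 0 i).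
rewrite portE !mxE !eqxx indicE mem_set//= mulr1 => /eqP.
by rewrite oner_eq0.
Qed.

End AttainableClaims.

Arguments filtration_measurable {disp Omega R T P F} FP t [B] _ : rename.
Arguments date_measurable {disp Omega R d T P F} FP j [B] _ : rename.

(** * From the polar of the bounded claims to dual processes *)

Section PolarOfClaims.
Context {disp : measure_display} {Omega : measurableType disp} {R : realType}.
Context {d T : nat}.
Variables (P : probability Omega R) (F : 'I_T.+1 -> set (set Omega)).
Variable K : cone_process Omega R d T.
Hypothesis FP : filtration P F.
Hypothesis KP : in_calK P F K.
Variable Q : probability Omega R.
Hypothesis PQ : equiv_prob P Q.

Local Notation idx := ('I_T.+1 * 'I_d)%type.
Local Notation proc := (process Omega R d T).
Local Notation adaptedp := (L0_process P (fun=> setT) F).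
Local Notation A := (attainable_s P F 0 K).
Local Notation FI := (@date_filtration _ Omega d T F).
Local Notation L2 := (square_integrable Q FI).

(** The polar of the bounded super-attainable claims.  Boundedness keeps the
    pairing finite for every square integrable Z and still leaves enough
    claims to test the conditions that define D(K, Q). *)
Definition polar_claims (Z : idx -> Omega -> R) : Prop := L2 Z /\
  forall (v : proc) (c : R), A v -> (forall t w i, `|v t w 0 i| <= c) ->
    mip Q Z (coords v) <= 0.

Lemma ae_QP (p : Omega -> Prop) : {ae Q, forall w, p w} -> {ae P, forall w, p w}.
Proof. by apply: dominated_ae; case: PQ. Qed.

Lemma ae_PQ (p : Omega -> Prop) : {ae P, forall w, p w} -> {ae Q, forall w, p w}.
Proof. by apply: dominated_ae; case: PQ. Qed.

Lemma adapted_measurable_fun (f : Omega -> R) t : measurable_wrt (F t) f ->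
  measurable_fun (setT : set Omega) f.
Proof.
by move=> mf; exact: (measurable_wrt_measurable (filtration_sigma FP t)
  (filtration_measurable FP t) mf).
Qed.

Lemma measurable_wrt_dot t (x y : Omega -> 'rV[R]_d) :
  (forall i, measurable_wrt (F t) (fun w => x w 0 i)) ->
  (forall i, measurable_wrt (F t) (fun w => y w 0 i)) ->
  measurable_wrt (F t) (fun w => dot (x w) (y w)).
Proof.
by move=> mx my; apply: measurable_sum => i; apply: measurable_funM; [exact: mx|exact: my].
Qed.

Lemma square_integrable_bounded (X : idx -> Omega -> R) (c : R) : adapted FI X ->
  (forall j w, `|X j w| <= c) -> L2 X.
Proof.
move=> aX Xc; split => //.
apply: (@integrable_rv_le _ _ _ _ _ (fun=> \sum_(j : idx) c ^+ 2)).
- by apply: (measurable_ip (date_sigma FP) (date_measurable FP)).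
- exact: integrable_rv_cst.
move=> w; rewrite !ger0_norm ?ip_ge0 ?sumr_ge0// => [|j _]; last exact: sqr_ge0.
apply: ler_sum => j _; rewrite -expr2 -[X j w ^+ 2]real_normK ?num_real//.
by rewrite lerXn2r ?nnegrE// (le_trans _ (Xc j w)).
Qed.

Lemma square_integrable_component (X : idx -> Omega -> R) j : L2 X ->
  integrable_rv Q (X j).
Proof.
move=> [aX iX]; apply: (@integrable_rv_le _ _ _ _ _ (fun w => 1 + ip X X w)).
- exact: (adapted_measurable (date_sigma FP) (date_measurable FP)).
- by apply: integrable_rvD => //; exact: integrable_rv_cst.
move=> w; have X2 := le_ip X j w; have X0 := ip_ge0 X w.
rewrite [leRHS]ger0_norm ?addr_ge0//.
have := sqr_ge0 (`|X j w| - 1).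
by move: X2; rewrite -[X j w ^+ 2]real_normK ?num_real//; nra.
Qed.

Lemma integrable_dot_bounded t (k y : Omega -> 'rV[R]_d) (c : R) :
  (forall i, measurable_wrt (F t) (fun w => k w 0 i)) ->
  (forall w i, `|k w 0 i| <= c) ->
  (forall i, integrable_rv Q (fun w => y w 0 i)) ->
  integrable_rv Q (fun w => dot (k w) (y w)).
Proof.
move=> mk kc iy; apply: integrable_rv_sum => i _.
by apply: (@integrable_rvM_bounded _ _ _ _ c) => //; exact: adapted_measurable_fun.
Qed.

(** Apply the hypothesis to the generators X n of K_t, cut off to the event
    where they are bounded by m and their product with y is negative: that
    event must be null for every m. *)
Lemma polar_of_mean t (y : Omega -> 'rV[R]_d) :
  (forall i, measurable_wrt (F t) (fun w => y w 0 i)) ->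
  (forall i, integrable_rv Q (fun w => y w 0 i)) ->
  (forall (k : Omega -> 'rV[R]_d) (c : R),
    (forall i, measurable_wrt (F t) (fun w => k w 0 i)) ->
    (forall w i, `|k w 0 i| <= c) -> {ae P, forall w, K t w (k w)} ->
    0 <= \int[Q]_w dot (k w) (y w)) ->
  {ae P, forall w, polar (K t w) (y w)}.
Proof.
move=> my iy Ey; have [[X [aX XK]] _] := KP.
have mX n i : measurable_wrt (F t) (fun w => X n t w 0 i) by case: (aX n t) => + _; exact.
suff Xy : {ae P, forall w n, 0 <= dot (X n t w) (y w)}.
  by apply: filterS2 Xy (XK t) => w Xy [_ _ ->]; exact: polar_cone.
apply: ae_foralln => n; apply: ae_QP.
pose rho w := \sum_i `|X n t w 0 i|.
have mdot := measurable_wrt_dot (mX n) my.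
have mrho : measurable_wrt (F t) rho.
  by apply: measurable_sum => i; apply: measurableT_comp => //; exact: mX.
pose B m : set Omega := [set w | dot (X n t w) (y w) < 0] `&` [set w | rho w <= m%:R].
have mB m : measurable_wrt (F t) (\1_(B m) : Omega -> R).
  apply: measurable_indic; apply: measurableI.
    have := mdot measurableT _ (measurable_itv `]-oo, (0:R)[).
    by rewrite setTI; congr measurable; apply/seteqP; split => w /=; rewrite in_itv.
  have := mrho measurableT _ (measurable_itv `]-oo, (m%:R:R)]).
  by rewrite setTI; congr measurable; apply/seteqP; split => w /=; rewrite in_itv.
(* a bounded selection of K_t whose product with y is nonpositive *)
pose k m w := \1_(B m) w *: X n t w.
have mk m i : measurable_wrt (F t) (fun w => k m w 0 i).
  rewrite (_ : (fun w => _) = fun w => \1_(B m) w * X n t w 0 i).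
    by apply: measurable_funM; [exact: mB|exact: mX].
  by apply/funext => w; rewrite mxE.
have kb m w i : `|k m w 0 i| <= m%:R.
  rewrite mxE indicE; case: (boolP (w \in B m)) => [/set_mem[_ /= rm]|_]; last first.
    by rewrite mul0r normr0.
  rewrite mul1r (le_trans _ rm)// /rho (bigD1 i)//= lerDl.
  exact: sumr_ge0.
have Kk m : {ae P, forall w, K t w (k m w)}.
  apply: filterS2 (solvency_cone KP t) (XK t) => w [K0 _] [_ _ KE].
  rewrite /k indicE; case: (w \in B m); last by rewrite scale0r.
  by rewrite scale1r KE; exact: cone_gen.
have k0 m : {ae Q, forall w, - dot (k m w) (y w) = 0}.
  have ik : integrable_rv Q (fun w => dot (k m w) (y w)).
    exact: (integrable_dot_bounded (mk m) (kb m)).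
  apply: mean_eq0; first exact: integrable_rvN.
    apply: aeW => w; rewrite /k dotZl indicE oppr_ge0.
    case: (boolP (w \in B m)) => [/set_mem[/= /ltW + _]|_]; rewrite ?mul1r ?mul0r//.
  have := meanZ (-1) ik; rewrite mulN1r => e.
  rewrite (_ : Rintegral _ _ _ = - \int[Q]_w dot (k m w) (y w)).
    by rewrite oppr_le0; exact: (Ey _ m%:R).
  by rewrite -e; apply: eq_Rintegral => w _; rewrite mulN1r.
apply: filterS (ae_foralln k0) => w k0w; rewrite leNgt; apply/negP => neg.
have rho0 : 0 <= rho w by exact: sumr_ge0.
have := k0w (Num.trunc (rho w)).+1; rewrite /k dotZl indicE mem_set.
  by rewrite mul1r => /eqP; rewrite oppr_eq0 => /eqP h; rewrite h ltxx in neg.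
split => //=; apply: ltW; exact: truncnS_gt.
Qed.

(** Both polarity conditions follow from polar_of_mean: the claim - k at date t
    alone tests Z_t, and the portfolio that acquires - k at date t and holds it
    tests the tail sum of Z, which is then replaced by its conditional
    expectation. *)
Lemma polar_claims_calD Z : polar_claims Z -> calD P F K Q (process_of Z).
Proof.
move=> [[aZ iZ] Zv].
have sZ : L2 Z by [].
have ac X : adaptedp X -> adapted FI (coords X) by move=> /adapted_coords.
have aZp : adaptedp (process_of Z) by exact: adapted_process_of.
have iZc t i : integrable_rv Q (fun w => process_of Z t w 0 i).
  have := square_integrable_component (t, i) sZ.
  by apply: eq_integrable => // w _ /=; rewrite mxE.
(* the position that holds k at date t and nothing at the other dates *)
pose at_t (t : 'I_T.+1) (k : Omega -> 'rV[R]_d) : proc := fun s w => if s == t then k w else 0.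
have at_adapted (t : 'I_T.+1) (k : Omega -> 'rV[R]_d) :
    (forall i, measurable_wrt (F t) (fun w => k w 0 i)) ->
    adaptedp (at_t t k).
  move=> mk s; rewrite /at_t; case: eqP => [->|_]; last exact: adapted_process0.
  by split => //; exact: aeW.
have at_solvent (t : 'I_T.+1) (k : Omega -> 'rV[R]_d) : {ae P, forall w, K t w (k w)} ->
    forall s, {ae P, forall w, K s w (at_t t k s w)}.
  move=> Kk s; rewrite /at_t; case: eqP => [->//|_].
  by apply: filterS (solvency_cone KP s) => w [].
have Zpolar (t : 'I_T.+1) : {ae P, forall w, polar (K t w) (process_of Z t w)}.
  apply: polar_of_mean => [i|//|k c mk kc Kk]; first by case: (aZp t) => + _; exact.
  have := Zv _ c (attainable_sub KP (at_adapted _ _ mk) (at_solvent _ _ Kk)).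
  have vc s w i : `|(- at_t t k s w) 0 i| <= c.
    rewrite mxE normrN /at_t; case: eqP => // _.
    by rewrite mxE normr0 (le_trans _ (kc w i)).
  move=> /(_ vc); rewrite -oppr_ge0 => /le_trans; apply; rewrite le_eqVlt; apply/orP; left.
  have ik := integrable_dot_bounded mk kc (iZc t).
  rewrite -mulN1r /mip -meanZ; last first.
    apply: (square_integrable_ip (date_sigma FP) (date_measurable FP)) => //.
    apply: (@square_integrable_bounded _ c) => [|[s i] w]; last exact: vc.
    by apply: ac; case/attainableE: (attainable_sub KP (at_adapted _ _ mk) (at_solvent _ _ Kk)).
  apply/eqP; apply: eq_Rintegral => w _.
  rewrite ipC -{1}(process_ofK Z) ip_coords (bigD1 t)//= big1 => [|s st].
    by rewrite /at_t eqxx dotNl; ring.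
  by rewrite /at_t (negbTE st) oppr0 dot0l.
have iS t i : integrable_rv Q
    (fun w => (\sum_(s < T.+1 | (t <= s)%N) process_of Z s w) 0 i).
  have := integrable_rv_sum (index_enum 'I_T.+1) (fun s (_ : (t <= s)%N) => iZc s i).
  by apply: eq_integrable => // w _ /=; rewrite summxE.
split.
  split => // t; split; first by case: (aZp t).
  by apply: filterS2 (Zpolar t) (solvency_orthant KP t) => w Zw; exact.
move=> t; split => //.
have /choice[Yb Ybc] : forall i, exists Y, is_condexp Q (F t)
   (fun w => (\sum_(s < T.+1 | (t <= s)%N) process_of Z s w) 0 i) Y.
  move=> i; apply: condexp_exists => //.
    exact: (filtration_sigma FP).
  exact: (filtration_measurable FP).
pose Zb w : 'rV[R]_d := \row_i Yb i w.
have ZbE i : (fun w => Zb w 0 i) = Yb i by apply/funext => w; rewrite mxE.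
exists Zb; split => [i|]; first by rewrite ZbE.
apply: polar_of_mean => [i|i|k c mk kc Kk].
- by rewrite ZbE; case: (Ybc i).
- by rewrite ZbE; case: (Ybc i).
pose xi : proc := fun s w => - at_t t k s w.
have axi : adaptedp xi.
  by case/attainableE: (attainable_sub KP (at_adapted _ _ mk) (at_solvent _ _ Kk)).
have Axi : calA P F K xi.
  split => // s; apply: filterS (at_solvent _ _ Kk s) => w.
  by rewrite /xi opprK.
have VE s w : portfolio 0 xi s w = if (t <= s)%N then - k w else 0.
  rewrite /portfolio add0r; case: leqP => ts.
    rewrite (bigD1 t)//= /xi {1}/at_t eqxx big1 ?addr0// => r /andP[_ rt].
    by rewrite /at_t (negbTE rt) oppr0.
  rewrite big1// => r rs; rewrite /xi /at_t; case: eqP => [rt|_]; last by rewrite oppr0.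
  by move: rs; rewrite rt leqNgt ts.
have Vc s w i : `|portfolio 0 xi s w 0 i| <= c.
  rewrite VE; case: ifP => _; first by rewrite mxE normrN.
  by rewrite mxE normr0 (le_trans _ (kc w i)).
have := Zv _ c (attainable_portfolio FP KP Axi) Vc.
rewrite -oppr_ge0 => /le_trans; apply; rewrite le_eqVlt; apply/orP; left; apply/eqP.
rewrite -mulN1r /mip -meanZ; last first.
  apply: (square_integrable_ip (date_sigma FP) (date_measurable FP)) => //.
  apply: (@square_integrable_bounded _ c) => [|[s i] w]; last exact: Vc.
  by apply: ac; exact: (adapted_portfolio FP).
have iYb i : integrable_rv Q (fun w => k w 0 i * Zb w 0 i).
  apply: (@integrable_rvM_bounded _ _ _ _ c) => //; first exact: adapted_measurable_fun (mk i).
  by rewrite ZbE; case: (Ybc i).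
have iYS i : integrable_rv Q
    (fun w => k w 0 i * (\sum_(s < T.+1 | (t <= s)%N) process_of Z s w) 0 i).
  apply: (@integrable_rvM_bounded _ _ _ _ c) => //; first exact: adapted_measurable_fun (mk i).
rewrite [RHS]mean_sum// (eq_bigr (fun i => \int[Q]_w (k w 0 i *
   (\sum_(s < T.+1 | (t <= s)%N) process_of Z s w) 0 i))); last first.
  move=> i _; apply/esym.
  have Zbc : is_condexp Q (F t)
      (fun w => (\sum_(s < T.+1 | (t <= s)%N) process_of Z s w) 0 i)
      (fun w => Zb w 0 i) by rewrite ZbE.
  exact: (condexp_mean (filtration_sigma FP t) (filtration_measurable FP t)
    (iS t i) Zbc (mk i) (kc ^~ i)).
rewrite -mean_sum//; apply: eq_Rintegral => w _.
rewrite ipC -{1}(process_ofK Z) ip_coords.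
rewrite -[RHS]/(dot (k w) (\sum_(s < T.+1 | (t <= s)%N) process_of Z s w)).
rewrite dotC dot_suml [in RHS]big_mkcond/= mulr_sumr; apply: eq_bigr => s _.
rewrite VE; case: ifP => _; first by rewrite dotNl dotC; ring.
by rewrite dot0l mulr0.
Qed.

End PolarOfClaims.

(** * Separating and positive dual processes *)

Section DualProcesses.
Context {disp : measure_display} {Omega : measurableType disp} {R : realType}.
Context {d T : nat}.
Variables (P : probability Omega R) (F : 'I_T.+1 -> set (set Omega)).
Variable K : cone_process Omega R d T.
Hypothesis FP : filtration P F.
Hypothesis KP : in_calK P F K.
Hypothesis KC : closed_in_measure P (attainable_s P F 0 K).
Hypothesis NAK : NA P F K.
Variable Q : probability Omega R.
Hypothesis PQ : equiv_prob P Q.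

Local Notation idx := ('I_T.+1 * 'I_d)%type.
Local Notation proc := (process Omega R d T).
Local Notation adaptedp := (L0_process P (fun=> setT) F).
Local Notation A := (attainable_s P F 0 K).
Local Notation FI := (@date_filtration _ Omega d T F).
Local Notation L2 := (square_integrable Q FI).
Local Notation polarc := (polar_claims P F K Q).
Local Notation fam := (idx -> Omega -> R).

Let sFI := date_sigma (d := d) FP.
Let mFI := date_measurable (d := d) FP.

Lemma adapted_scale (g : 'I_T.+1 -> Omega -> R) (Y : fam) :
  (forall t, measurable_wrt (F t) (g t)) -> adapted FI Y ->
  adapted FI (fun j w => g j.1 w * Y j w).
Proof.
by move=> mg aY j; apply: measurable_funM; [exact: (mg j.1)|exact: (aY j)].
Qed.

(** The weight exp(- |x|^2) is at most 1 and at most 1 / (1 + |x|^2), so that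
    its square times x_i^2 is at most 1. *)
Lemma gaussian_weight_bound (n : nat) (x : 'rV[R]_n) i :
  `|expR (- dot x x) * x 0 i| <= 1.
Proof.
have g0 := expR_gt0 (- dot x x); have g1 : expR (- dot x x) <= 1.
  by rewrite -expR0 ler_expR oppr_le0 dot_ge0.
have gx : expR (- dot x x) * (1 + dot x x) <= 1.
  have := expR_ge1Dx (dot x x); rewrite -(ler_pM2l g0) => /le_trans; apply.
  by rewrite -expRD addNr expR0.
have xi := sqr_le_dot x i; have xx := dot_ge0 x.
rewrite -[leRHS](normr1 R) -ler_sqr ?nnegrE// !real_normK ?num_real// expr1n exprMn.
by nra.
Qed.

(** The weights g t make theta bounded, and they are adapted, so that the
    residual of the projection in weighted coordinates gives an adapted Z. *)
Lemma separating_claims (theta : proc) : adaptedp theta -> ~ A theta ->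
  exists Z, [/\ polarc Z,
    forall t, integrable_rv Q (fun w => dot (theta t w) (process_of Z t w)) &
    0 < \int[Q]_w \sum_t dot (theta t w) (process_of Z t w)].
Proof.
move=> ath nAth.
have ac (X : proc) : adaptedp X -> adapted FI (coords X) by move=> /adapted_coords.
pose e t w := dot (theta t w) (theta t w).
have me t : measurable_wrt (F t) (e t).
  by apply: measurable_wrt_dot => i; case: (ath t) => + _; exact.
(* h is the inverse of the weight g *)
pose g t w := expR (- e t w); pose h t w := expR (e t w).
have mg t : measurable_wrt (F t) (g t).
  by apply: measurableT_comp => //; apply: measurable_funN; exact: me.
have mh t : measurable_wrt (F t) (h t) by apply: measurableT_comp => //; exact: me.
have hg t w : h t w * g t w = 1 by rewrite /h /g -expRD addrN expR0.
have g01 t w : 0 < g t w <= 1.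
  by rewrite expR_gt0/= -expR0 ler_expR oppr_le0 dot_ge0.
pose C (u : fam) := A (fun t w => h t w *: process_of u t w).
pose x : fam := fun j w => g j.1 w * coords theta j w.
have ax : adapted FI x by apply: adapted_scale => //; exact: ac.
have sx : L2 x.
  apply: (@square_integrable_bounded _ _ _ _ _ _ _ FP Q _ 1) => // j w.
  exact: gaussian_weight_bound.
have Cx : ~ C x.
  apply: contra_not nAth; rewrite /C; congr (attainable_s _ _ _ _ _).
  apply/funext => t; apply/funext => w; apply/rowP => i.
  by rewrite !mxE mulrA hg mul1r.
have C0 : C (fun _ _ => 0).
  have := attainable0 FP KP; congr (attainable_s _ _ _ _ _).
  by apply/funext => t; apply/funext => w; apply/rowP => i; rewrite !mxE mulr0.
have C_comb a b X Y : 0 <= a -> 0 <= b -> C X -> C Y -> C (comb a X b Y).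
  move=> a0 b0 CX CY; have := attainable_comb KP a0 b0 CX CY.
  congr (attainable_s _ _ _ _ _).
  apply/funext => t; apply/funext => w; apply/rowP => i.
  by rewrite !mxE /comb; ring.
have C_closed (X : nat -> fam) Y : (forall n, C (X n)) -> adapted FI Y ->
    (forall j, {ae Q, forall w, X n j w @[n --> \oo] --> Y j w}) -> C Y.
  move=> CX aY XY; apply: (attainable_closed FP KC CX).
    apply/adapted_coords.
    rewrite (_ : coords _ = fun j w => h j.1 w * Y j w); first exact: adapted_scale.
    by apply/funext => -[t i]; apply/funext => w; rewrite /coords !mxE.
  move=> j; apply: (ae_QP PQ); apply: filterS (XY j) => w XYw.
  rewrite /coords !mxE -surjective_pairing.
  rewrite (_ : (fun n => _) = (fun n => h j.1 w * X n j w)).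
    by apply: cvgM => //; exact: cvg_cst.
  by apply/funext => n; rewrite !mxE -surjective_pairing.
have [Y [sY Yx YC]] := cone_separation sFI mFI C0 C_comb C_closed sx Cx.
pose Z : fam := fun j w => g j.1 w * Y j w.
have thetaZ t w i : theta t w 0 i * process_of Z t w 0 i = x (t, i) w * Y (t, i) w.
  by rewrite mxE /x /Z /coords/=; ring.
exists Z; split.
- split.
    split; first by apply: adapted_scale => //; case: sY.
    case: sY => aY iY; apply: (integrable_rv_le _ iY).
      by apply: (measurable_ip sFI mFI); exact: adapted_scale.
    move=> w; rewrite !ger0_norm ?ip_ge0//; apply: ler_sum => j _.
    rewrite /Z -!expr2 exprMn ler_piMl ?sqr_ge0//.
    by have /andP[g0 g1] := g01 j.1 w; rewrite exprn_ile1// ltW.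
  move=> v c Av vc.
  have av : adapted FI (coords v) by apply: ac; case/attainableE: Av.
  pose u : fam := fun j w => g j.1 w * coords v j w.
  have -> : mip Q Z (coords v) = mip Q Y u.
    apply: eq_Rintegral => w _; apply: eq_bigr => j _.
    by rewrite /Z /u; ring.
  apply: YC.
    rewrite /C; move: Av; congr (attainable_s _ _ _ _ _).
    apply/funext => t; apply/funext => w; apply/rowP => i.
    by rewrite !mxE /u/= mulrA hg mul1r.
  apply: (@square_integrable_bounded _ _ _ _ _ _ _ FP Q _ c); first exact: adapted_scale.
  move=> j w; have /andP[g0 g1] := g01 j.1 w.
  rewrite normrM (ger0_norm (ltW g0)) (le_trans _ (vc j.1 w j.2))//.
  by rewrite ler_piMl.
- move=> t; apply: integrable_rv_sum => i _.
  apply: (@integrable_rv_le _ _ _ _ _ (fun w => ip x x w + ip Y Y w)).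
  + apply: measurable_funM; first by exact: (adapted_measurable sFI mFI (t, i) (ac _ ath)).
    rewrite (_ : (fun w => _) = Z (t, i)); last by apply/funext => w; rewrite mxE.
    by apply: (adapted_measurable sFI mFI); apply: adapted_scale => //; case: sY.
  + by apply: integrable_rvD; [case: sx|case: sY].
  move=> w; rewrite thetaZ [leRHS]ger0_norm ?addr_ge0 ?ip_ge0//.
  have := le_ip x (t, i) w; have := le_ip Y (t, i) w.
  by rewrite ler_norml => *; apply/andP; split; nra.
- move: Yx; rewrite mipC; congr (0 < _); apply: eq_Rintegral => w _.
  by rewrite -ip_coords process_ofK; apply: eq_bigr => j _; rewrite /x /Z; ring.
Qed.

Lemma polar_claims_comb (a b : R) (X Y : fam) : 0 <= a -> 0 <= b ->
  polarc X -> polarc Y -> polarc (comb a X b Y).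
Proof.
move=> a0 b0 [sX vX] [sY vY]; split; first exact: (square_integrable_comb sFI mFI).
move=> v c Av vc; have sv : L2 (coords v).
  apply: (@square_integrable_bounded _ _ _ _ _ _ _ FP Q _ c) => [|j w]; last exact: vc.
  by case/attainableE: Av => /adapted_coords.
rewrite (mip_combl sFI mFI)//.
by have := vX _ _ Av vc; have := vY _ _ Av vc; nra.
Qed.

Lemma polar_claims0 : polarc (fun _ _ => 0).
Proof.
split.
  split; first by move=> j; exact: measurable_cst.
  rewrite (_ : ip _ _ = fun=> 0); first exact: integrable_rv_cst.
  by apply/funext => w; rewrite /ip big1// => j _; rewrite mul0r.
move=> v c _ _; rewrite /mip (_ : (fun w => _) = fun=> 0) ?mean_cst//.
by apply/funext => w; rewrite /ip big1// => j _; rewrite mul0r.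
Qed.

Lemma polar_claims_ge0 Z j : polarc Z -> {ae Q, forall w, 0 <= Z j w}.
Proof.
move=> pZ; have [[ZK _] _] := polar_claims_calD FP KP PQ pZ.
apply: (ae_PQ PQ); case: j => t i; have [_] := ZK t.
by apply: filterS => w /(_ i); rewrite mxE.
Qed.

(** The weights a n make the partial sums fast Cauchy.  All terms are
    nonnegative almost surely, so that the partial sums increase to W; this gives
    both the domination needed for the limit of the pairings and the
    inclusion of the supports. *)
Lemma polar_claims_series (Z : nat -> fam) : (forall n, polarc (Z n)) ->
  exists W, polarc W /\
    forall n j, {ae Q, forall w, 0 < Z n j w -> 0 < W j w}.
Proof.
move=> pZ.
have sZ n : L2 (Z n) by case: (pZ n).
(* a n ^ 2 |Z n|^2 <= 8^-n *)
pose a n := 8^-1 ^+ n / (1 + mip Q (Z n) (Z n)).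
have den n : 0 < 1 + mip Q (Z n) (Z n) by rewrite ltr_pwDl// mip_ge0.
have a0 n : 0 < a n by rewrite divr_gt0// exprn_gt0.
pose S n : fam := fun j w => \sum_(k < n) a k * Z k j w.
have SE n : S n.+1 = comb 1 (S n) (a n) (Z n).
  apply/funext => j; apply/funext => w.
  by rewrite /S /comb big_ord_recr/= mul1r.
have pS n : polarc (S n).
  elim: n => [|n IH]; last by rewrite SE; apply: polar_claims_comb => //; exact: ltW.
  have := polar_claims0; congr (polar_claims _ _ _ _ _).
  by apply/funext => j; apply/funext => w; rewrite /S big_ord0.
have sS n : L2 (S n) by case: (pS n).
have Sfast n : mip Q (comb 1 (S n.+1) (-1) (S n)) (comb 1 (S n.+1) (-1) (S n))
    <= 1 * 8^-1 ^+ n.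
  have -> : comb 1 (S n.+1) (-1) (S n) = comb (a n) (Z n) 0 (Z n).
    by apply/funext => j; apply/funext => w; rewrite SE /comb; ring.
  rewrite (mip_comb sFI mFI)//; set q := mip Q (Z n) (Z n).
  have q0 : 0 <= q by exact: mip_ge0.
  have ae : a n * (1 + q) = 8^-1 ^+ n by rewrite /a divfK// gt_eqF.
  have : (8^-1 : R) ^+ n <= 1 by rewrite exprn_ile1// invf_le1// ler1n.
  rewrite -ae; have := a0 n; set b := a n => b0 b1.
  have : b <= 1 by nra.
  by nra.
have [W [sW SW]] := square_integrable_fast_cvg sFI mFI sS Sfast.
have Z0 : {ae Q, forall w, forall n j, 0 <= Z n j w}.
  by apply: ae_foralln => n; apply: filter_forall => j; exact: polar_claims_ge0.
have cS : {ae Q, forall w, forall j, S n j w @[n --> \oo] --> W j w}.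
  exact: filter_forall.
have SleW : {ae Q, forall w, forall n j, 0 <= S n j w <= W j w}.
  apply: filterS2 Z0 cS => w Zw cw n j.
  have nd : nondecreasing_seq (fun n => S n j w).
    by apply/nondecreasing_seqP => m; rewrite /S big_ord_recr/= lerDl mulr_ge0// ltW.
  rewrite sumr_ge0 => [|k _]; last by rewrite mulr_ge0// ltW.
  rewrite -(cvg_lim (@Rhausdorff R) (cw j)); apply: nondecreasing_cvgn_le => //.
  by apply/cvg_ex; exists (W j w); exact: cw.
exists W; split; last first.
  move=> n j; apply: filterS2 SleW Z0 => w SWw Zw Znw.
  have /andP[_] := SWw n.+1 j; apply: lt_le_trans.
  rewrite /S big_ord_recr/= ltr_wpDl ?(mulr_gt0 (a0 n) Znw)//.
  by apply: sumr_ge0 => k _; rewrite mulr_ge0// ltW.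
split => // v c Av vc.
have av : adapted FI (coords v) by case/attainableE: Av => /adapted_coords.
have aS n : adapted FI (S n) by case: (sS n).
have aW : adapted FI W by case: sW.
have lim : mip Q (S n) (coords v) @[n --> \oo] --> mip Q W (coords v).
  apply: (@mean_dominated _ _ _ _ _ _ (fun w => \sum_j W j w * `|c|)).
  - by move=> n; exact: (measurable_ip sFI mFI).
  - exact: (measurable_ip sFI mFI).
  - apply: integrable_rv_sum => j _.
    have := integrable_rvZ `|c| (square_integrable_component FP j sW).
    by apply: eq_integrable => // w _ /=; rewrite mulrC.
  - move=> n; apply: filterS SleW => w SWw.
    rewrite (le_trans (ler_norm_sum _ _ _))//; apply: ler_sum => j _.
    have /andP[s0 sW'] := SWw n j; rewrite normrM ger0_norm//.
    by apply: ler_pM => //; rewrite (le_trans (vc j.1 w j.2))// ler_norm.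
  - apply: filterS cS => w cw; apply: cvgn_sum => j.
    by apply: cvgM => //; exact: cvg_cst.
rewrite -(cvg_lim (@Rhausdorff R) lim); apply: limr_le.
  by apply/cvg_ex; eexists; exact: lim.
by apply: nearW => n; case: (pS n) => _ /(_ _ _ Av vc).
Qed.

(** Maximise the mean number of positive coordinates.  The series of a
    maximising sequence attains the supremum; if a coordinate of it vanished on
    a non-null event, adding a process that separates the unit claim on this
    event would increase the score. *)
Lemma exists_positive_claims : exists Z, polarc Z /\
  forall j, {ae Q, forall w, 0 < Z j w}.
Proof.
pose pos (Z : fam) j := [set w | 0 < Z j w].
have mpos Z j : adapted FI Z -> F j.1 (pos Z j).
  move=> aZ; rewrite (_ : pos Z j = Z j @^-1` `]0, +oo[%classic).
    apply: (measurable_wrt_preimage (filtration_sigma FP j.1)) => //; exact: (aZ j).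
  by apply/seteqP; split => w /=; rewrite in_itv/= andbT.
have iind Z j : adapted FI Z -> integrable_rv Q (\1_(pos Z j) : Omega -> R).
  move=> aZ; have mp := filtration_measurable FP j.1 (mpos _ _ aZ).
  apply: (@integrable_rv_le _ _ _ _ _ (fun=> 1)); last first.
  - by move=> w; rewrite indicE; case: (_ \in _); rewrite ?normr0 ?normr1.
  - exact: integrable_rv_cst.
  - exact: measurable_indic.
pose score (Z : fam) w : R := \sum_j \1_(pos Z j) w.
have iscore Z : adapted FI Z -> integrable_rv Q (score Z).
  by move=> aZ; apply: integrable_rv_sum => j _; exact: iind.
pose V := [set \int[Q]_w score Z w | Z in polarc].
have supV : has_sup V.
  split.
    by exists (\int[Q]_w score (fun _ _ => 0) w), (fun _ _ => 0); first exact: polar_claims0.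
  exists #|{: idx}|%:R => _ [Z [[aZ _] _] <-].
  rewrite -(mean_cst Q #|{: idx}|%:R); apply: mean_le_ae; first exact: iscore.
    exact: integrable_rv_cst.
  apply: aeW => w; rewrite -sum1_card natr_sum; apply: ler_sum => j _.
  by rewrite indicE; case: (_ \in _).
have /choice[Zn Znp] : forall n : nat, exists Z, polarc Z /\
    sup V < \int[Q]_w score Z w + n.+1%:R^-1.
  move=> n; have [|_ [Z pZ <-] h] := @sup_adherent _ V n.+1%:R^-1 _ supV.
    by rewrite invr_gt0.
  by exists Z; split => //; rewrite -ltrBlDr.
have [W [pW WZ]] := polar_claims_series (fun n => (Znp n).1).
have aW : adapted FI W by case: pW => -[].
have supW : sup V <= \int[Q]_w score W w.
  rewrite leNgt; apply/negP => /ltr_add_invr[k].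
  apply/negP; rewrite -leNgt; apply: ltW; apply: (lt_le_trans (Znp k).2).
  rewrite lerD2r; apply: mean_le_ae; [|exact: iscore|].
    by apply: iscore; case: (Znp k).1 => -[].
  have WZk : {ae Q, forall w, forall j, 0 < Zn k j w -> 0 < W j w}.
    by apply: filter_forall => j; exact: WZ.
  apply: filterS WZk => w Ww; apply: ler_sum => j _; rewrite !indicE.
  have [/set_mem/= Zkw|_] := boolP (w \in pos (Zn k) j); last by rewrite ler0n.
  by rewrite mem_set//=; exact: Ww.
exists W; split => // -[t i].
pose B := ~` pos W (t, i).
have FB : F t B.
  case: (filtration_sigma FP t) => _ FC _; have := FC _ (mpos W (t, i) aW).
  by rewrite setTD.
pose theta : proc := fun s w => if s == t then \1_B w *: delta_mx 0 i else 0.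
(* if the unit claim on B is attainable then B is null *)
have [Ath|nAth] := pselect (A theta).
  have PB := no_arbitrage_claim FP KP NAK FB Ath.
  apply: (ae_PQ PQ); exists B; split => //.
  exact: (filtration_measurable FP t FB).
have ath : adaptedp theta.
  move=> s; rewrite /theta; case: eqP => [->|_]; last exact: adapted_process0.
  split; last exact: aeW.
  move=> k; rewrite (_ : (fun w => _) = fun w => \1_B w * (delta_mx 0 i : 'rV[R]_d) 0 k).
    apply: measurable_funM; last exact: measurable_cst.
    exact: measurable_wrt_indic.
  by apply/funext => w; rewrite mxE.
have [Z [pZ _]] := separating_claims ath nAth.
have aZ : adapted FI Z by case: pZ => -[].
have -> : \int[Q]_w (\sum_t0 dot (theta t0 w) (process_of Z t0 w)) =
    \int[Q]_w (\1_B w * Z (t, i) w).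
  apply: eq_Rintegral => w _; rewrite (bigD1 t)//= big1 ?addr0.
    by rewrite /theta eqxx dotZl dot_delta mxE.
  by move=> s st; rewrite /theta (negbTE st) dot0l.
pose W' := comb 1 W 1 Z.
have pW' : polarc W' by exact: polar_claims_comb.
have aW' : adapted FI W' by case: pW' => -[].
have W0 : {ae Q, forall w, forall j, 0 <= W j w}.
  by apply: filter_forall => j; exact: polar_claims_ge0.
have Z0 : {ae Q, forall w, forall j, 0 <= Z j w}.
  by apply: filter_forall => j; exact: polar_claims_ge0.
have le_ind : {ae Q, forall w, forall j, \1_(pos W j) w <= (\1_(pos W' j) w : R)}.
  apply: filterS Z0 => w Zw j; rewrite !indicE.
  have [/set_mem/= Ww|_] := boolP (w \in pos W j); last by rewrite ler0n.
  by rewrite mem_set// /pos/= /W' /comb !mul1r ltr_wpDr.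
have D0 : {ae Q, forall w, score W' w - score W w = 0}.
  apply: mean_eq0.
  - by apply: integrable_rvB; exact: iscore.
  - by apply: filterS le_ind => w h; rewrite subr_ge0; apply: ler_sum => j _.
  rewrite meanB ?subr_le0; [|exact: iscore..].
  by apply: le_trans supW; apply: ub_le_sup; [case: supV|exists W'].
have B0 : {ae Q, forall w, \1_B w * Z (t, i) w <= 0}.
  apply: filterS3 le_ind D0 W0 => w le_w D0w W0w.
  rewrite indicE; have [/set_mem Bw|_] := boolP (w \in B); last by rewrite mul0r.
  rewrite mul1r leNgt; apply/negP => Zw; move: D0w.
  rewrite /score -sumrB (bigD1 (t, i))//= => D0w.
  have rest : 0 <= \sum_(j | j != (t, i)) (\1_(pos W' j) w - \1_(pos W j) w : R).
    by apply: sumr_ge0 => j _; rewrite subr_ge0.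
  have i1 : \1_(pos W' (t, i)) w = 1 :> R.
    by rewrite indicE mem_set// /pos/= /W' /comb !mul1r ltr_wpDl.
  have i2 : \1_(pos W (t, i)) w = 0 :> R by rewrite indicE memNset.
  by move: D0w rest; rewrite i1 i2; set r := \sum_(_ | _) _ => e0 r0; lra.
rewrite ltNge => /negP; case.
rewrite -(mean_cst Q 0); apply: mean_le_ae => //; last exact: integrable_rv_cst.
apply: (@integrable_rvM_bounded _ _ _ _ 1).
- exact: measurable_indic (filtration_measurable FP t FB).
- by move=> w; rewrite indicE; case: (_ \in _); rewrite ?normr0 ?normr1.
- by apply: (square_integrable_component FP); case: pZ.
Qed.

End DualProcesses.

(** * Supermartingales without integrability *)

Section GeneralisedSupermartingale.
Context {disp : measure_display} {Omega : measurableType disp} {R : realType}.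
Variable Q : probability Omega R.
Implicit Types (X Y U f : Omega -> R) (G : set (set Omega)).

(** E[X | G] <= Y without integrability: U dominates X, and U and Y have the
    same mean against every weight phi in [0, 1] that is measurable with respect
    to G and vanishes where the G-measurable variable rho is large. *)
Definition local_supermartingale_step G Y X : Prop :=
  exists rho U : Omega -> R, [/\ measurable_wrt G rho, {ae Q, forall w, X w <= U w} &
    forall (phi : Omega -> R) (n : nat), measurable_wrt G phi ->
      (forall w, 0 <= phi w <= 1) -> (forall w, n%:R < rho w -> phi w = 0) ->
      [/\ integrable_rv Q (fun w => phi w * U w),
          integrable_rv Q (fun w => phi w * Y w) &
          \int[Q]_w (phi w * U w) = \int[Q]_w (phi w * Y w)]].

Section Step.
Variables (G : set (set Omega)) (X Y : Omega -> R).
Hypothesis sG : sigma_algebra setT G.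
Hypothesis GM : G `<=` measurable.
Hypothesis mY : measurable_wrt G Y.
Hypothesis mX : measurable_fun (setT : set Omega) X.
Hypothesis YX : local_supermartingale_step G Y X.
Hypothesis iXn : integrable_rv Q X^\-.

Let below (rho : Omega -> R) (n : nat) : set Omega := [set w | rho w <= n%:R].

Let mbelow rho n : measurable_wrt G rho ->
  measurable_wrt G (\1_(below rho n) : Omega -> R).
Proof.
move=> mrho; apply: measurable_indic.
have := mrho measurableT _ (measurable_itv `]-oo, (n%:R:R)]).
by rewrite setTI; congr measurable; apply/seteqP; split => w /=; rewrite in_itv.
Qed.

Let below01 rho n w : 0 <= (\1_(below rho n) w : R) <= 1.
Proof. by rewrite indicE ler0n lern1 leq_b1. Qed.

Let below0 (rho : Omega -> R) (n : nat) w : n%:R < rho w -> \1_(below rho n) w = 0 :> R.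
Proof. by move=> h; rewrite indicE memNset//= /below/=; apply/negP; rewrite -ltNge. Qed.

Let cvg_below (rho f : Omega -> R) w :
  \1_(below rho n) w * f w @[n --> \oo] --> f w.
Proof.
apply: cvg_near_cst; exists (Num.trunc `|rho w|).+1 => // n /= rn.
rewrite indicE mem_set ?mul1r// /below/=.
rewrite (le_trans (ler_norm _))// ltW// (lt_le_trans (truncnS_gt _))//.
by rewrite ler_nat.
Qed.

Let mO f : measurable_wrt G f -> measurable_fun (setT : set Omega) f.
Proof. exact: measurable_wrt_measurable. Qed.

(** Integrate the negative part of Y over the events where rho <= n: it is
    bounded by the mean of the negative part of X, uniformly in n. *)
Lemma step_neg_integrable : integrable_rv Q Y^\-.
Proof.
have [rho [U [mrho XU UY]]] := YX.
pose neg := [set w | Y w < 0].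
have mneg : measurable_wrt G (\1_neg : Omega -> R).
  apply: measurable_indic; have := @mY measurableT _ (measurable_itv `]-oo, (0:R)[).
  by rewrite setTI; congr measurable; apply/seteqP; split => w /=; rewrite in_itv.
pose phi n w : R := \1_(below rho n) w * \1_neg w.
have mphi n : measurable_wrt G (phi n).
  by apply: measurable_funM => //; exact: mbelow.
have phi01 n w : 0 <= phi n w <= 1.
  have /andP[b0 b1] := below01 rho n w.
  rewrite /phi [\1_neg w]indicE; case: (_ \in _); rewrite ?mulr1 ?mulr0 ?b0//.
  by rewrite lexx ler01.
have phi0 n w : n%:R < rho w -> phi n w = 0.
  by move=> h; rewrite /phi below0// mul0r.
have negE n w : \1_(below rho n) w * Y^\- w = -1 * (phi n w * Y w).
  rewrite /phi /funrneg [\1_neg w]indicE; have [/set_mem/= Yw|Yw] := boolP (w \in neg).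
    by rewrite max_l ?oppr_ge0 1?ltW//; ring.
  rewrite max_r; first by rewrite !mulr0 mul0r mulr0.
  by rewrite oppr_le0 leNgt; apply: contra Yw => ?; exact/mem_set.
have iphiU n : integrable_rv Q (fun w => phi n w * U w).
  by case: (UY _ _ (mphi n) (phi01 n) (phi0 n)).
have iphiY n : integrable_rv Q (fun w => phi n w * Y w).
  by case: (UY _ _ (mphi n) (phi01 n) (phi0 n)).
have [] // : integrable_rv Q Y^\- /\ \int[Q]_w Y^\- w <= \int[Q]_w X^\- w.
apply: (@mean_fatou _ _ _ _ (fun n w => \1_(below rho n) w * Y^\- w)).
- move=> n; rewrite (_ : (fun w => _) = fun w => -1 * (phi n w * Y w)).
    exact: integrable_rvZ.
  by apply/funext => w; exact: negE.
- by move=> n w; rewrite mulr_ge0 ?funrneg_ge0//; case/andP: (below01 rho n w).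
- by apply: measurable_funrneg; exact: mO.
- exact: funrneg_ge0.
- by apply: aeW => w; exact: cvg_below.
- apply: nearW => n; under eq_Rintegral do rewrite negE.
  rewrite meanZ//; have [_ _ <-] := UY _ _ (mphi n) (phi01 n) (phi0 n).
  rewrite -meanZ//; apply: mean_le_ae => //; first exact: integrable_rvZ.
  apply: filterS XU => w XUw; have /andP[p0 p1] := phi01 n w.
  have X0 := funrneg_ge0 X w.
  have XN : - X w <= X^\- w by rewrite /funrneg le_max lexx.
  by nra.
Qed.

(** On the events where rho <= n the positive part of X has mean at most
    E|Y| plus the mean of the negative part of X; let n tend to infinity. *)
Lemma step_mean_le : integrable_rv Q Y ->
  integrable_rv Q X /\ \int[Q]_w X w <= \int[Q]_w Y w.
Proof.
move=> iY; have [rho [U [mrho XU UY]]] := YX.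
pose phi n w : R := \1_(below rho n) w.
have {}UY n := UY _ _ (mbelow n mrho) (below01 rho n) (@below0 rho n).
have iphiU n : integrable_rv Q (fun w => phi n w * U w) by case: (UY n).
have mphi n : measurable_fun (setT : set Omega) (phi n) by apply: mO; exact: mbelow.
have phi_norm n w : `|phi n w| <= 1.
  by have /andP[p0 p1] := below01 rho n w; rewrite ger0_norm.
have phiUY n : \int[Q]_w (phi n w * U w) = \int[Q]_w (phi n w * Y w) by case: (UY n).
have ibX (f : Omega -> R) n : integrable_rv Q f -> integrable_rv Q (fun w => phi n w * f w).
  exact: integrable_rvM_bounded.
have Xpos w : X^\+ w = X w + X^\- w.
  have <- : X^\+ w - X^\- w = X w by rewrite -[in RHS](funrposBneg X).
  by rewrite subrK.
have le_pos n : {ae Q, forall w, phi n w * X^\+ w <= phi n w * U w + X^\- w}.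
  apply: filterS XU => w XUw; have /andP[p0 p1] := below01 rho n w.
  have X0 := funrneg_ge0 X w; rewrite Xpos mulrDr lerD//.
    by rewrite ler_wpM2l.
  by rewrite ler_piMl.
have mXp : measurable_fun setT X^\+ by exact: measurable_funrpos.
have ipos n : integrable_rv Q (fun w => phi n w * X^\+ w).
  apply: (integrable_rv_le_ae (Y := fun w => phi n w * U w + X^\- w)).
  - exact: measurable_funM.
  - exact: integrable_rvD.
  - apply: filterS (le_pos n) => w; apply: le_trans.
    by rewrite ger0_norm// mulr_ge0 ?funrpos_ge0// /phi indicE ler0n.
have [iXp _] : integrable_rv Q X^\+ /\
    \int[Q]_w X^\+ w <= \int[Q]_w `|Y w| + \int[Q]_w X^\- w.
  apply: (@mean_fatou _ _ _ _ (fun n w => phi n w * X^\+ w)) => //.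
  - by move=> n w; rewrite mulr_ge0 ?funrpos_ge0// /phi indicE ler0n.
  - by apply: aeW => w; exact: cvg_below.
  - apply: nearW => n; apply: le_trans (mean_le_ae (ipos n) _ (le_pos n)) _.
      exact: integrable_rvD.
    rewrite meanD// lerD2r phiUY; apply: mean_le_ae; first exact: ibX.
      exact: integrable_rv_norm.
    apply: aeW => w; rewrite (le_trans (ler_norm _))// normrM ler_piMl//.
have iX : integrable_rv Q X.
  have := integrable_rvB iXp iXn; congr integrable_rv.
  by apply/funext => w; rewrite Xpos addrK.
split => //.
have lim (f : Omega -> R) : integrable_rv Q f ->
    \int[Q]_w (phi n w * f w) @[n --> \oo] --> \int[Q]_w f w.
  move=> if_; apply: (@mean_dominated _ _ _ _ _ _ (fun w => `|f w|)).
  - by move=> n; apply: measurable_funM => //; exact: integrable_rv_measurable if_.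
  - exact: integrable_rv_measurable if_.
  - exact: integrable_rv_norm.
  - by move=> n; apply: aeW => w; rewrite normrM ler_piMl.
  - by apply: aeW => w; exact: cvg_below.
apply: (ler_cvg_to (lim _ iX) (lim _ iY)); apply: nearW => n.
rewrite -phiUY; apply: mean_le_ae => //; first exact: ibX.
by apply: filterS XU => w XUw; rewrite ler_wpM2l// /phi indicE ler0n.
Qed.

End Step.

(** step_neg_integrable propagates integrability of the negative parts from n
    down to 0, and step_mean_le propagates integrability and the sign of the mean
    from 0 up to n. *)
Lemma generalised_supermartingale (n : nat) (N : nat -> Omega -> R)
    (G : nat -> set (set Omega)) :
  (forall t, sigma_algebra setT (G t)) -> (forall t, G t `<=` measurable) ->
  (forall t, measurable_wrt (G t) (N t)) ->
  (forall t, (t < n)%N -> local_supermartingale_step (G t) (N t) (N t.+1)) ->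
  {ae Q, forall w, N 0%N w <= 0} -> integrable_rv Q (N n)^\- ->
  integrable_rv Q (N n) /\ \int[Q]_w N n w <= 0.
Proof.
move=> sG GM mN stepN N0 iNn.
have mO t : measurable_fun (setT : set Omega) (N t).
  exact: (measurable_wrt_measurable (sG t) (@GM t)).
have neg k : (k <= n)%N -> integrable_rv Q (N (n - k)%N)^\-.
  elim: k => [|k IH] kn; first by rewrite subn0.
  apply: (step_neg_integrable (sG _) (@GM _) (mN _) (X := N (n - k)%N)).
    have -> : (n - k = (n - k.+1).+1)%N by rewrite subnSK.
    by apply: stepN; rewrite ltn_subrL (leq_ltn_trans _ kn).
  exact: IH (ltnW kn).
have negt t : (t <= n)%N -> integrable_rv Q (N t)^\-.
  by move=> tn; rewrite -(subKn tn); apply: neg; exact: leq_subr.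
have : forall t, (t <= n)%N -> integrable_rv Q (N t) /\ \int[Q]_w N t w <= 0.
  elim=> [_|t IH tn].
    have i0 : integrable_rv Q (N 0%N).
      apply: (integrable_rv_le_ae (Y := (N 0%N)^\-)) => //; first exact: negt.
      by apply: filterS N0 => w Nw; rewrite ler0_norm// /funrneg le_max lexx.
    split => //; rewrite -(mean_cst Q 0); apply: mean_le_ae => //.
    exact: integrable_rv_cst.
  have [iN Nle] := IH (ltnW tn).
  have [iN' N'le] := step_mean_le (sG t) (@GM t) (mO t.+1) (stepN t tn) (negt _ tn) iN.
  by split => //; exact: le_trans Nle.
by apply.
Qed.

End GeneralisedSupermartingale.

(** * Dual processes price attainable claims at most at zero *)

Section SuperhedgingBound.
Context {disp : measure_display} {Omega : measurableType disp} {R : realType}.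
Context {d T : nat}.
Variables (P : probability Omega R) (F : 'I_T.+1 -> set (set Omega)).
Variable K : cone_process Omega R d T.
Hypothesis FP : filtration P F.
Variable Q : probability Omega R.
Hypothesis PQ : equiv_prob P Q.

Local Notation proc := (process Omega R d T).
Local Notation adaptedp := (L0_process P (fun=> setT) F).
Local Notation A := (attainable_s P F 0 K).

Lemma polar_calA_le0 (xi y : Omega -> 'rV[R]_d) t :
  {ae P, forall w, K t w (- xi w)} -> {ae P, forall w, polar (K t w) (y w)} ->
  {ae Q, forall w, dot (xi w) (y w) <= 0}.
Proof.
move=> Kxi Ky; apply: (ae_PQ PQ); apply: filterS2 Kxi Ky => w h /(_ _ h).
by rewrite dotNl oppr_ge0.
Qed.

Lemma portfolio_step (xi : proc) (s t : 'I_T.+1) w : (t : nat) = s.+1 ->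
  portfolio 0 xi t w = portfolio 0 xi s w + xi t w.
Proof.
move=> ts; rewrite /portfolio !add0r (bigD1 t)//= addrC; congr (_ + _).
apply: eq_bigl => r; rewrite -(inj_eq val_inj)/= ts.
by rewrite andbC -ltn_neqAle ltnS.
Qed.

(** The process N below is a supermartingale in the generalised sense.  Beyond
    the last date the tail sum of Z is zero, so that N at T + 1 is the total
    pairing of the portfolio with Z. *)
Lemma gains_mean_le0 (xi Z : proc) : calA P F K xi -> calD P F K Q Z ->
  integrable_rv Q (fun w => \sum_t dot (portfolio 0 xi t w) (Z t w))^\- ->
  integrable_rv Q (fun w => \sum_t dot (portfolio 0 xi t w) (Z t w)) /\
  \int[Q]_w (\sum_t dot (portfolio 0 xi t w) (Z t w)) <= 0.
Proof.
move=> [axi Kxi] [[ZL0 iZ] ZK].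
pose V := portfolio 0 xi; have aV : adaptedp V by exact: adapted_portfolio.
have mV t i : measurable_wrt (F t) (fun w => V t w 0 i) by case: (aV t) => + _; exact.
have mZ t i : measurable_wrt (F t) (fun w => Z t w 0 i) by case: (ZL0 t) => + _; exact.
have /choice[Zb ZbP] : forall t, exists Zb : Omega -> 'rV[R]_d,
    (forall i, is_condexp Q (F t)
       (fun w => (\sum_(s < T.+1 | (t <= s)%N) Z s w) 0 i) (fun w => Zb w 0 i)) /\
    {ae P, forall w, polar (K t w) (Zb w)}.
  by move=> t; case: (ZK t).
(* dates are extended to all natural numbers by stopping at T *)
pose tt (m : nat) : 'I_T.+1 := inord (minn m T).
have ttE m : tt m = minn m T :> nat by rewrite inordK// ltnS geq_minr.
have tt_le m : (m <= T)%N -> tt m = m :> nat by move=> /minn_idPl mT; rewrite ttE.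
pose S (m : nat) w : 'rV[R]_d := \sum_(s < T.+1 | (m <= s)%N) Z s w.
pose Zc (m : nat) w : 'rV[R]_d := if (m <= T)%N then Zb (tt m) w else 0.
have iS m i : integrable_rv Q (fun w => S m w 0 i).
  have := integrable_rv_sum (index_enum 'I_T.+1) (fun s (_ : (m <= s)%N) => iZ s i).
  by apply: eq_integrable => // w _ /=; rewrite summxE.
have mZc m i : measurable_wrt (F (tt m)) (fun w => Zc m w 0 i).
  rewrite /Zc; case: (leqP m T) => mT; first by case: (ZbP (tt m)) => /(_ i) [] //.
  rewrite (_ : (fun w => _) = cst 0); first exact: measurable_cst.
  by apply/funext => w; rewrite mxE.
have iZc m i : integrable_rv Q (fun w => Zc m w 0 i).
  rewrite /Zc; case: (leqP m T) => mT; first by case: (ZbP (tt m)) => /(_ i) [].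
  rewrite (_ : (fun w => _) = fun=> 0); first exact: integrable_rv_cst.
  by apply/funext => w; rewrite mxE.
(* at each date, the tail sum of Z may be replaced by its conditional expectation *)
have tail (t : 'I_T.+1) (m : nat) (k : Omega -> 'rV[R]_d) (c : R) : (t <= m)%N ->
    (forall i, measurable_wrt (F t) (fun w => k w 0 i)) ->
    (forall w i, `|k w 0 i| <= c) ->
    \int[Q]_w dot (k w) (Zc m w) = \int[Q]_w dot (k w) (S m w).
  move=> tm mk kc; case: (leqP m T) => mT; last first.
    apply: eq_Rintegral => w _; rewrite /Zc leqNgt mT/= /S big1// => s ms.
    by have := leq_trans mT ms; rewrite ltnNge -ltnS ltn_ord.
  have mk' i : measurable_wrt (F (tt m)) (fun w => k w 0 i).
    apply: (measurable_wrt_sub (filtration_sigma FP t) (filtration_sigma FP _)) (mk i).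
    by apply: (filtration_le FP); rewrite tt_le.
  rewrite /dot !mean_sum => [|i _|i _]; last 2 first.
  - by apply: (integrable_rvM_bounded _ (kc ^~ i)) => //; exact: (adapted_measurable_fun FP (mk i)).
  - by apply: (integrable_rvM_bounded _ (kc ^~ i)) => //; exact: (adapted_measurable_fun FP (mk i)).
  apply: eq_bigr => i _; apply/esym.
  have [/(_ i) ce _] := ZbP (tt m).
  rewrite /Zc mT; apply: (condexp_mean (filtration_sigma FP (tt m))
    (filtration_measurable FP (tt m)) (iS m i) _ (mk' i) (kc ^~ i)).
  by move: ce; rewrite tt_le.
pose a (s : 'I_T.+1) w := dot (V s w) (Z s w).
pose past (m : nat) w : R := \sum_(s < T.+1 | (s < m)%N) a s w.
pose N (m : nat) w : R := past m w + dot (V (tt m) w) (Zc m w).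
have mpast m : measurable_wrt (F (tt m)) (past m).
  rewrite (_ : past m = fun w => \sum_(s < T.+1) (if (s < m)%N then a s w else 0)); last first.
    by apply/funext => w; rewrite /past big_mkcond.
  apply: measurable_sum => s; case: (ltnP s m) => sm; last exact: measurable_cst.
  have sG := filtration_sigma FP.
  have sub : F s `<=` F (tt m).
    by apply: (filtration_le FP); rewrite ttE leq_min (ltnW sm) -ltnS ltn_ord.
  exact: (measurable_wrt_sub (sG s) (sG (tt m)) sub (measurable_wrt_dot (mV s) (mZ s))).
have mN m : measurable_wrt (F (tt m)) (N m).
  exact: (measurable_funD (mpast m) (measurable_wrt_dot (mV (tt m)) (mZc m))).
have pastS m w : (m <= T)%N -> past m.+1 w = past m w + a (tt m) w.
  move=> mT; rewrite /past (bigD1 (tt m))/= ?tt_le// addrC; congr (_ + _).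
  apply: eq_bigl => s; rewrite -(inj_eq val_inj)/= tt_le// ltnS.
  by rewrite ltn_neqAle andbC.
have SS m w : (m <= T)%N -> S m w = Z (tt m) w + S m.+1 w.
  move=> mT; rewrite /S (bigD1 (tt m))/= ?tt_le//; congr (_ + _).
  apply: eq_bigl => s; rewrite -(inj_eq val_inj)/= tt_le//.
  by rewrite [RHS]ltn_neqAle andbC eq_sym.
have dot0r (x : 'rV[R]_d) : dot x 0 = 0 by rewrite dotC dot0l.
have dotDr (x y z : 'rV[R]_d) : dot x (y + z) = dot x y + dot x z.
  by rewrite dotC dotDl !(dotC x).
have NT w : N T.+1 w = \sum_t dot (V t w) (Z t w).
  rewrite /N /Zc ltnn dot0r addr0 /past; apply: eq_bigl => s.
  by rewrite ltn_ord.
have N0 : {ae Q, forall w, N 0%N w <= 0}.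
  have := polar_calA_le0 (Kxi (tt 0%N)) (ZbP (tt 0%N)).2.
  apply: filterS => w; rewrite /N /past big1// add0r /Zc leq0n.
  suff -> : V (tt 0%N) w = xi (tt 0%N) w by [].
  rewrite /V /portfolio add0r (bigD1 (tt 0%N))//= big1 ?addr0// => s /andP[].
  by rewrite tt_le// leqn0 -(inj_eq val_inj)/= tt_le// => /eqP->.
have stepN m : (m < T.+1)%N -> local_supermartingale_step Q (F (tt m)) (N m) (N m.+1).
  rewrite ltnS => mT.
  pose rho w : R := \sum_i `|V (tt m) w 0 i| + `|past m w|.
  exists rho, (fun w => past m.+1 w + dot (V (tt m) w) (Zc m.+1 w)); split.
  - apply: measurable_funD; last by apply: measurableT_comp => //; exact: mpast.
    by apply: measurable_sum => i; apply: measurableT_comp => //; exact: mV.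
  - case: (ltnP m T) => mT'; last first.
      by apply: aeW => w; rewrite /N /Zc ltnNge mT'/= !dot0r.
    have := polar_calA_le0 (Kxi (tt m.+1)) (ZbP (tt m.+1)).2.
    apply: filterS => w h; rewrite /N lerD2l /Zc mT'.
    by rewrite /V (@portfolio_step xi (tt m) (tt m.+1)) ?tt_le// dotDl gerDl.
  move=> phi n mphi phi01 phi0.
  pose k w := phi w *: V (tt m) w.
  have mk i : measurable_wrt (F (tt m)) (fun w => k w 0 i).
    rewrite (_ : (fun w => _) = fun w => phi w * V (tt m) w 0 i).
      by apply: measurable_funM => //; exact: mV.
    by apply/funext => w; rewrite mxE.
  have bound w (x : R) : `|x| <= rho w -> `|phi w * x| <= n%:R.
    move=> xr; have /andP[p0 p1] := phi01 w.
    case: (leP (rho w) n%:R) => [rn|/phi0->]; last by rewrite mul0r normr0.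
    by rewrite normrM (ger0_norm p0) (le_trans _ (le_trans xr rn))// ler_piMl.
  have kn w i : `|k w 0 i| <= n%:R.
    rewrite mxE; apply: bound; rewrite /rho (bigD1 i)//= -addrA lerDl.
    by rewrite addr_ge0// sumr_ge0.
  have ik (y : Omega -> 'rV[R]_d) : (forall i, integrable_rv Q (fun w => y w 0 i)) ->
      integrable_rv Q (fun w => dot (k w) (y w)).
    exact: (integrable_dot_bounded FP mk kn).
  have ip_ : integrable_rv Q (fun w => phi w * past m w).
    apply: (@integrable_rv_le _ _ _ _ _ (fun=> n%:R)).
    - apply: (adapted_measurable_fun FP (t := tt m)).
      exact: (measurable_funM mphi (mpast m)).
    - exact: integrable_rv_cst.
    - move=> w; rewrite [leRHS]ger0_norm//; apply: bound.
      by rewrite /rho lerDr sumr_ge0.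
  have UE w : phi w * (past m.+1 w + dot (V (tt m) w) (Zc m.+1 w)) =
      phi w * past m w + (dot (k w) (Z (tt m) w) + dot (k w) (Zc m.+1 w)).
    by rewrite pastS// /k !dotZl /a; ring.
  have YE w : phi w * N m w = phi w * past m w + dot (k w) (Zc m w).
    by rewrite /N /k dotZl; ring.
  have i1 : integrable_rv Q (fun w => dot (k w) (Z (tt m) w) + dot (k w) (Zc m.+1 w)).
    by apply: integrable_rvD; apply: ik.
  split.
  - rewrite (_ : (fun w => _) = fun w => phi w * past m w +
      (dot (k w) (Z (tt m) w) + dot (k w) (Zc m.+1 w))); last exact/funext.
    exact: integrable_rvD.
  - rewrite (_ : (fun w => _) = fun w => phi w * past m w + dot (k w) (Zc m w)); last exact/funext.
    by apply: integrable_rvD => //; exact: ik.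
  under eq_Rintegral do rewrite UE.
  under [RHS]eq_Rintegral do rewrite YE.
  rewrite meanD// [RHS]meanD//; last exact: ik.
  congr (_ + _); rewrite meanD; [|exact: ik..].
  rewrite (tail (tt m) m.+1 k n%:R)// ?tt_le// (tail (tt m) m k n%:R)// ?tt_le//.
  rewrite -meanD; [|exact: ik..].
  by apply: eq_Rintegral => w _; rewrite (SS m)// dotDr.
have -> : (fun w => \sum_t dot (portfolio 0 xi t w) (Z t w)) = N T.+1.
  by apply/funext => w; rewrite NT.
move=> iNn.
apply: (generalised_supermartingale (G := fun m => F (tt m))) => //.
- by move=> m; exact: (filtration_sigma FP).
- by move=> m; exact: (filtration_measurable FP).
Qed.

(** The dominating portfolio satisfies theta.Z <= V.Z at each date, so that the
    negative part of its total pairing is integrable. *)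
Lemma attainable_pairing_le0 (theta Z : proc) : A theta -> calD P F K Q Z ->
  neg_part_L1 F Q theta Z -> (pairing Q theta Z <= 0)%E.
Proof.
move=> /attainableE[ath [xi Axi VK]] DZ negZ.
pose X w : R := \sum_t dot (theta t w) (Z t w).
pose Y w : R := \sum_t dot (portfolio 0 xi t w) (Z t w).
pose neg w : R := \sum_t ((fun w => dot (theta t w) (Z t w))^\-) w.
have [[ZL0 _] ZK] := DZ.
have mO (U : proc) t : adaptedp U ->
    measurable_fun (setT : set Omega) (fun w => dot (U t w) (Z t w)).
  move=> aU; apply: (adapted_measurable_fun FP (t := t)).
  by apply: measurable_wrt_dot => i; [case: (aU t)|case: (ZL0 t)] => + _; exact.
have mX : measurable_fun (setT : set Omega) X by apply: measurable_sum => t; exact: mO.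
have mY : measurable_fun (setT : set Omega) Y.
  apply: measurable_sum => t; apply: mO; apply: (adapted_portfolio FP).
  by case: Axi.
have XY : {ae Q, forall w, X w <= Y w}.
  have VKZ : {ae Q, forall w, forall t,
      dot (theta t w) (Z t w) <= dot (portfolio 0 xi t w) (Z t w)}.
    apply: filter_forall => t; apply: (ae_PQ PQ).
    apply: filterS2 (VK t) (ZK t).1 => w h /(_ _ h).
    by rewrite dotBl subr_ge0.
  by apply: filterS VKZ => w h; exact: ler_sum.
have ineg : integrable_rv Q neg.
  by apply: integrable_rv_sum => t _; case: (negZ t).
have negX w : - X w <= neg w.
  by rewrite /X -sumrN; apply: ler_sum => t _; rewrite /funrneg le_max lexx.
have neg0 w : 0 <= neg w by apply: sumr_ge0 => t _; exact: funrneg_ge0.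
have iYn : integrable_rv Q Y^\-.
  apply: (integrable_rv_le_ae _ ineg); first exact: measurable_funrneg.
  apply: filterS XY => w XYw; rewrite ger0_norm ?funrneg_ge0// /funrneg ge_max neg0 andbT.
  by rewrite (le_trans _ (negX w))// lerN2.
have [iY EY] := gains_mean_le0 Axi DZ iYn.
have iX : integrable_rv Q X.
  apply: (integrable_rv_le_ae (Y := fun w => neg w + `|Y w|)) => //.
    by apply: integrable_rvD => //; exact: integrable_rv_norm.
  apply: filterS XY => w XYw; rewrite ler_norml; apply/andP; split.
    by have := negX w; have := normr_ge0 (Y w); lra.
  by have := ler_norm (Y w); have := neg0 w; lra.
rewrite /pairing unlock (meanE iX) lee_fin (le_trans _ EY)//.
exact: mean_le_ae.
Qed.

End SuperhedgingBound.

(** * Dual characterisation of super-attainable claims *)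

Theorem mainTheorem1 (R : realType) (disp : measure_display)
    (Omega : measurableType disp) (P : probability Omega R)
    (d T : nat) (F : 'I_T.+1 -> set (set Omega))
    (K : cone_process Omega R d T) :
  (0 < d)%N -> (0 < T)%N ->
  measure_is_complete P -> filtration P F ->
  in_calK P F K ->
  closed_in_measure P (attainable_s P F 0 K) ->
  NA P F K ->
  (forall Q : probability Omega R, equiv_prob P Q ->
     exists Z : process Omega R d T,
       calD P F K Q Z /\ L0_process P (fun=> pos_orthant) F Z) /\
  (forall theta : process Omega R d T, L0_process P (fun=> setT) F theta ->
     let i_ := attainable_s P F 0 K theta in
     let ii_ := forall Q : probability Omega R, equiv_prob P Q ->
       forall Z : process Omega R d T, calD P F K Q Z ->
         neg_part_L1 F Q theta Z -> (pairing Q theta Z <= 0)%E in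
     let iii_ := exists2 Q : probability Omega R, equiv_prob P Q &
       forall Z : process Omega R d T, calD P F K Q Z ->
         neg_part_L1 F Q theta Z -> (pairing Q theta Z <= 0)%E in
     (i_ <-> ii_) /\ (ii_ <-> iii_)).
Proof.
move=> _ _ _ FP KP KC NAK; split=> [Q PQ|theta ath].
  have [Z [pZ Zpos]] := exists_positive_claims FP KP KC NAK PQ.
  exists (process_of Z); split; first exact: (polar_claims_calD FP KP PQ).
  have aZ : L0_process P (fun=> setT) F (process_of Z).
    by apply: adapted_process_of; case: pZ => -[].
  move=> t; split; first by case: (aZ t).
  have Zpos' : {ae Q, forall w, forall j, 0 < Z j w} by exact: filter_forall.
  by apply: (ae_QP PQ); apply: filterS Zpos' => w Zw i; rewrite mxE.
move=> i_ ii_ iii_.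
have i_ii : i_ -> ii_.
  by move=> Ath Q PQ Z DZ negZ; exact: (attainable_pairing_le0 FP PQ Ath DZ negZ).
have PP : equiv_prob P P by split.
have ii_iii : ii_ -> iii_ by move=> h; exists P => //; exact: (h P PP).
have iii_i : iii_ -> i_.
  move=> [Q PQ h]; apply: contrapT => nAth.
  have [Z [pZ iZ]] := separating_claims FP KP KC PQ ath nAth.
  set X := (fun w => \sum_t _) => EX.
  have iX : integrable_rv Q X by exact: integrable_rv_sum.
  have := h _ (polar_claims_calD FP KP PQ pZ).
  rewrite /pairing unlock (meanE iX) lee_fin leNgt EX => /(_ _)/wrap[]//.
  move=> t; split; last exact: (integrable_funrneg measurableT (iZ t)).
  apply: measurable_funrneg; apply: measurable_wrt_dot => i.
    by case: (ath t) => + _; exact.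
  have aZ : L0_process P (fun=> setT) F (process_of Z).
    by apply: adapted_process_of; case: pZ => -[].
  by case: (aZ t) => + _; exact.
by split; split => // h; [exact: (iii_i (ii_iii h))|exact: (i_ii (iii_i h))].
Qed.
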